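(* Let $m,d\geq 1$ be integers, let $(X_i)_{i\in\mathbb Z}=(X_0\circ T^i)_{i\in\mathbb Z}$ be a strictly stationary sequence taking values in $\mathbb R^d$ and let $p\geq 1$. Suppose that the measurable function $h\colon(\mathbb R^d)^m\to\mathbb R$ and $(X_0\circ T^i)_{i\in\mathbb Z}$ satisfy the following assumptions: (1) the collection $\{|h(X_{i_1},\dots,X_{i_m})|^p : 1\leq i_1<\dots<i_m\}$ is uniformly integrable; (2) for each $(i_1,\dots,i_m)$ such that $1\leq i_1<\dots<i_m$, the vector $(X_{i_1},\dots,X_{i_m})$ has a density $f_{i_1,\dots,i_m}$ (with respect to Lebesgue measure on $(\mathbb R^d)^m$) and there exists $q_0>1$ such that $$M_1:=\sup_{1\leq i_1<\dots<i_m}\int_{(\mathbb R^d)^m}f_{i_1,\dots,i_m}(t_1,\dots,t_m)^{q_0}\,dt_1\cdots dt_m<\infty;$$ (3) for almost every $\omega$, the measure $\mu_\omega$ admits a density $f_\omega$ with respect to the Lebesgue measure on $\mathbb R^d$, and there exist a set $\Omega'$ having probability one and $q_1>1$ for which $$M_2:=\sup_{\omega\in\Omega'}\int_{\mathbb R^d}f_\omega(t)^{q_1}\,dt<\infty;$$ (4) the integral $\int_\Omega\int_{(\mathbb R^d)^m}|h(x_1,\dots,x_m)|^p\,d\mu_\omega(x_1)\cdots d\mu_\omega(x_m)\,d\mathbb P(\omega)$ is finite. Then $$\lim_{n\to\infty}\left\|U_{m,n,h}-I_m(\mathbb R^d,h,\cdot)\right\|_p=0.$$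
   Context: $(\Omega,\mathcal F,\mathbb P)$ is a probability space and $T\colon\Omega\to\Omega$ is a measure-preserving map (invertible with measurable inverse, so that $T^i$ makes sense for all $i\in\mathbb Z$). $X_0\colon\Omega\to\mathbb R^d$ is Borel measurable and $X_i=X_0\circ T^i$. No ergodicity is assumed. For $n\geq m$, the $U$-statistic of order $m$ with kernel $h$ is $$U_{m,n,h}=\frac1{\binom nm}\sum_{1\leq i_1<i_2<\dots<i_m\leq n}h(X_{i_1},\dots,X_{i_m}).$$ $\mathcal I$ denotes the $\sigma$-algebra of invariant sets, i.e. the sets $E\in\mathcal F$ such that $T^{-1}E=E$. The random probability measure $\mu_\omega$ on $\mathcal B(\mathbb R^d)$ is defined by $\mu_\omega(A)=\mathbb E[\mathbf 1_{X_0\in A}\mid\mathcal I](\omega)$, $A\in\mathcal B(\mathbb R^d)$ (a regular conditional distribution of $X_0$ given $\mathcal I$). $I_m(\mathbb R^d,h,\cdot)$ denotes the random variable $$\omega\mapsto I_m(\mathbb R^d,h,\omega)=\int_{(\mathbb R^d)^m}h(x_1,\dots,x_m)\,d\mu_\omega(x_1)\cdots d\mu_\omega(x_m).$$ For a real random variable $Z$, $\|Z\|_p=(\mathbb E[|Z|^p])^{1/p}$. *)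

(* Defs.v *)
From HB Require Import structures.
From mathcomp Require Import all_boot all_order all_algebra.
From mathcomp Require Import all_classical all_reals all_analysis.

Set Implicit Arguments.
Unset Strict Implicit.
Unset Printing Implicit Defensive.

Import Order.TTheory GRing.Theory Num.Theory.
Import numFieldNormedType.Exports.

Local Open Scope classical_set_scope.
Local Open Scope ring_scope.

(* R^d is d.-tuple (measurableTypeR R): the library's sigma-algebra on tuples
   is the one generated by the coordinates, here the Borel sigma-algebra. *)
Notation Rvec R d := (d.-tuple (measurableTypeR R)).

(* The n-fold product measure on n.-tuple T, which the library only provides
   for pairs.  The recursion identifies T * n.-tuple T with n.+1.-tuple T;
   mpower_box below gives the values on boxes. *)
Section mpower.
Context d (T : measurableType d) (R : realType).
Local Open Scope ereal_scope.

Definition tcons n (xt : T * n.-tuple T) : n.+1.-tuple T :=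
  [tuple of xt.1 :: xt.2].

Fixpoint mpower (mu : set T -> \bar R) n : set (n.-tuple T) -> \bar R :=
  match n with
  | 0 => dirac [tuple]
  | n'.+1 => pushforward (mu \x @mpower mu n') (@tcons n')
  end.
Arguments mpower : clear implicits.

Lemma measurable_tcons n : measurable_fun [set: T * n.-tuple T] (@tcons n).
Proof. exact: measurable_cons. Qed.

Variable mu : {sigma_finite_measure set T -> \bar R}.

Lemma mpower_is_measure n :
  exists m : {sigma_finite_measure set (n.-tuple T) -> \bar R},
    mpower mu n = m :> (set (n.-tuple T) -> \bar R).
Proof.
elim: n => [|n [m IH]]; first by exists (dirac [tuple]).
pose nu_ : {measure set (n.+1.-tuple T) -> \bar R} :=
  pushforward (mu \x m) (@tcons n).
pose nu := nu_ (@measurable_tcons n).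
have nuS : sigma_finite setT nu.
  have /sigma_finiteP[F [FT ndF Foo]] := sigma_finiteT mu.
  have /sigma_finiteP[G [GT ndG Goo]] := sigma_finiteT m.
  exists (fun k => [set t | F k (thead t) /\ G k [tuple of behead t]]).
    apply/esym; rewrite -subTset => t _.
    have [i _ Fi] : (\bigcup_i F i) (thead t) by rewrite -FT.
    have [j _ Gj] : (\bigcup_i G i) [tuple of behead t] by rewrite -GT.
    exists (maxn i j) => //; split.
      by move: (thead t) Fi; exact/subsetPset/ndF/leq_maxl.
    by move: [tuple of behead t] Gj; exact/subsetPset/ndG/leq_maxr.
  move=> k; have [mF oF] := Foo k; have [mG oG] := Goo k; split.
    apply: measurableI.
      by rewrite -[X in measurable X]setTI; exact: measurable_tnth.
    by rewrite -[X in measurable X]setTI; exact: measurable_behead.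
  rewrite /nu/nu_/= /pushforward.
  rewrite (_ : _ @^-1` _ = F k `*` G k).
    by rewrite product_measure1E// lte_mul_pinfty// ge0_fin_numE.
  apply/seteqP; split => -[x t] /=; rewrite /tcons theadE /=.
    by move=> [? Gt]; split => //=; congr (G k _): Gt; exact/val_inj.
  by move=> [? Gt]; split => //=; congr (G k _): Gt; exact/val_inj.
pose sf := Measure_isSigmaFinite.Build _ _ _ _ nuS.
pose nu' : {sigma_finite_measure set (n.+1.-tuple T) -> \bar R} :=
  HB.pack (pushforward (mu \x m) (@tcons n)) nu sf.
by exists (nu' (@measurable_tcons n)); rewrite /= IH.
Qed.

Let mpower0 n : mpower mu n set0 = 0.
Proof. by have [m ->] := mpower_is_measure n. Qed.

Let mpower_ge0 n A : 0 <= mpower mu n A.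
Proof. by have [m ->] := mpower_is_measure n. Qed.

Let mpower_sigma_additive n : semi_sigma_additive (mpower mu n).
Proof.
by have [m ->] := mpower_is_measure n; exact: measure_semi_sigma_additive.
Qed.

HB.instance Definition _ n := isMeasure.Build _ _ _ (mpower mu n)
  (mpower0 n) (@mpower_ge0 n) (@mpower_sigma_additive n).

Let mpower_sigma_finite n : sigma_finite setT (mpower mu n).
Proof. by have [m ->] := mpower_is_measure n; exact: sigma_finiteT. Qed.

HB.instance Definition _ n := Measure_isSigmaFinite.Build _ _ _ (mpower mu n)
  (mpower_sigma_finite n).

Lemma mpower_box n (A : 'I_n -> set T) : (forall i, measurable (A i)) ->
  mpower mu n [set t | forall i, A i (tnth t i)] = \prod_(i < n) mu (A i).
Proof.
elim: n A => [|n IH] A mA.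
  rewrite big_ord0 /= diracE mem_set//.
  by move=> [].
rewrite big_ord_recl /= /pushforward.
set B := _ @^-1` _.
have -> : B = A ord0 `*` [set t | forall i, A (lift ord0 i) (tnth t i)].
  apply/seteqP; split => [[x t] /= H|[x t] /= [H0 H] i].
    split; first exact: (H ord0).
    by move=> i; have := H (lift ord0 i); rewrite tnthS.
  by case: (unliftP ord0 i) => [j ->|-> //]; rewrite tnthS.
rewrite product_measure1E//; first by congr (_ * _); exact: (IH (fun i => A (lift ord0 i))).
rewrite (_ : [set t | _] =
    \bigcap_(i in [set: 'I_n]) (@tnth n T ^~ i @^-1` A (lift ord0 i))).
  apply: fin_bigcap_measurable => // i _.
  by rewrite -[X in measurable X]setTI; exact: measurable_tnth.
by apply/seteqP; split => t /= H i; [move=> _; exact: H|exact: (H i I)].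
Qed.

End mpower.
Arguments mpower {d T R} mu n A.

Definition lebesgue_Rvec (R : realType) d :
    {sigma_finite_measure set (Rvec R d) -> \bar R} :=
  mpower lebesgue_measure d.

Definition has_density d (T : measurableType d) (R : realType)
    (nu lam : set T -> \bar R) (f : T -> R) : Prop :=
  [/\ measurable_fun setT f, forall x, 0 <= f x &
      forall A, measurable A -> nu A = (\int[lam]_(x in A) (f x)%:E)%E].

Section probability_notions.
Context d (Omega : measurableType d) (R : realType) (P : probability Omega R).

Definition uniformly_integrable (I : Type) (D : set I) (Y : I -> Omega -> R) :
    Prop :=
  (fun K : R => ereal_sup
    [set \int[P]_(w in [set w | (K < `|Y i w|)%R]) (`|Y i w|%R)%:E | i in D]%E)
  @ +oo --> 0%E.

(* Z is a version of E[Y | G], for G a sub-sigma-algebra. *)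
Definition is_cond_expectation (G : set (set Omega)) (Y Z : Omega -> R) : Prop :=
  [/\ forall B : set R, measurable B -> G (Z @^-1` B),
      P.-integrable setT (EFin \o Z) &
      forall E, G E ->
        (\int[P]_(w in E) (Z w)%:E = \int[P]_(w in E) (Y w)%:E)%E].

Definition measure_preserving_automorphism (T Tinv : Omega -> Omega) : Prop :=
  [/\ measurable_fun setT T, measurable_fun setT Tinv,
      cancel T Tinv, cancel Tinv T &
      forall A, measurable A -> P (T @^-1` A) = P A].

(* Strict invariance, not invariance up to a null set. *)
Definition invariant_sets (T : Omega -> Omega) : set (set Omega) :=
  [set E | measurable E /\ T @^-1` E = E].

(* mu w A is a version of P(X0 \in A | G)(w), and each mu w is a probability. *)
Definition regular_cond_distribution d' (V : measurableType d')
    (G : set (set Omega)) (X0 : Omega -> V) (mu : Omega -> probability V R) :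
    Prop :=
  forall A, measurable A ->
    is_cond_expectation G \1_(X0 @^-1` A) (fun w => fine (mu w A)).

End probability_notions.

(* T^i for an integer i, Tinv being the inverse of T. *)
Definition iterz (S : Type) (T Tinv : S -> S) (i : int) : S -> S :=
  match i with Posz n => iter n T | Negz n => iter n.+1 Tinv end.

Definition shift_process (S V : Type) (T Tinv : S -> S) (X0 : S -> V)
    (i : int) : S -> V :=
  X0 \o iterz T Tinv i.

(* 1 <= i_1 < ... < i_m *)
Definition increasing_index (s : seq nat) : bool :=
  all (leq 1) s && sorted ltn s.

Section ustatistics.
Context (S V : Type) (R : realType) (m : nat).
Variables (h : m.-tuple V -> R) (X : int -> S -> V).

Definition sample (i : m.-tuple nat) (w : S) : m.-tuple V :=
  [tuple of map (fun k : nat => X k w) i].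

(* Used for n >= m only; it is 0 for n < m. *)
Definition Ustat (n : nat) (w : S) : R :=
  'C(n, m)%:R^-1 *
  \sum_(i : m.-tuple 'I_n.+1 | increasing_index (map val i))
     h (sample (map_tuple val i) w).

End ustatistics.

(* Real-valued: the integral is 0 at the w where it is not finite, which under
   the integrability hypothesis of the theorem form a null set. *)
Definition random_integral (S : Type) d (V : measurableType d) (R : realType) (m : nat)
    (mu : S -> probability V R) (h : m.-tuple V -> R) (w : S) : R :=
  (\int[mpower (mu w) m]_x h x)%R.

(* Main.v *)
Require Import Defs.
From HB Require Import structures.
From mathcomp Require Import all_boot all_order all_algebra.
From mathcomp Require Import all_classical all_reals all_analysis.
From mathcomp Require Import measurable_realfun.
From mathcomp Require Import lra ring zify.

(** The proof separates the ergodic theory, which is only needed for product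
    kernels, from an approximation argument that reaches all other kernels.

    Product kernels.  For h = 1_(A_1) x ... x 1_(A_m) the sum over
    i_1 < ... < i_m <= n satisfies S_(m+1)(n) = sum_(k < n) a_(k+1) S_m(k),
    where a is the indicator sequence of the last factor along the orbit
    [increasing_sumS].  By Birkhoff's theorem, applied to bounded observables
    [birkhoff], for almost every w the indicator sequence of A_j along the
    orbit of w has Cesaro mean mu_w(A_j): the conditional distribution is an
    invariant function, and subtracting it leaves an observable whose integral
    over each invariant set vanishes.  A deterministic statement on weighted
    Cesaro means, proved by Abel summation [cvg_increasing_sum], then gives
    U_n --> prod_j mu_w(A_j) almost surely, hence in L^p since everything is
    bounded by 1 [Uconverges_box].

    Approximation.  By Jensen's inequality both |U_n(h - g)|^p and
    |I(h - g)|^p are controlled in mean by the p-th moments of h - g, along the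
    samples and under the mixture of the powers of mu_w.  So the kernels
    for which the theorem holds are closed under approximation in these
    moments, provided that it is uniform over the samples [Uconverges_approx].
    This is used three times: for increasing unions in the pi-lambda theorem,
    which leads from boxes to all measurable sets [Uconverges_indic]; for
    uniform limits of step functions, which leads to bounded kernels
    [Uconverges_bounded]; and for truncations, where uniform integrability is
    exactly the uniformity required [Uconverges_uniformly_integrable].

    Densities.  In the first of these three steps the laws of all the samples
    must be small simultaneously on sets that decrease to the empty set.
    Densities bounded in L^q make them uniformly absolutely continuous with
    respect to a sigma-finite reference measure; that measure may be infinite,
    but stationarity makes the laws uniformly tight, which reduces the question
    to a set of finite reference measure [density_uniformly_vanishing]. *)

Set Implicit Arguments.
Unset Strict Implicit.
Unset Printing Implicit Defensive.

Import Order.TTheory GRing.Theory Num.Theory.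
Import numFieldNormedType.Exports.

Local Open Scope classical_set_scope.
Local Open Scope ring_scope.

(** * Sums over increasing indices *)

(** The recursion is Pascal's: an increasing sequence of length m+1 bounded by
    n+1 either stays below n+1 or ends with it. *)
Fixpoint incseqs (n m : nat) {struct n} : seq (seq nat) :=
  match m, n with
  | 0, _ => [:: [::]]
  | _.+1, 0 => [::]
  | m'.+1, n'.+1 => incseqs n' m ++ [seq rcons s n | s <- incseqs n' m']
  end.

Lemma incseqsn0 n : incseqs n 0 = [:: [::]]. Proof. by case: n. Qed.

Lemma increasing_index_rcons s k :
  increasing_index (rcons s k) =
  [&& increasing_index s, all (ltn^~ k) s & (1 <= k)%N].
Proof.
rewrite /increasing_index all_rcons !(sorted_pairwise ltn_trans).
rewrite -cats1 pairwise_cat allrel1r /= andbT.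
by case: (0 < k)%N; case: (all _ s); case: (all _ s); case: (pairwise _ s).
Qed.

Lemma mem_incseqs n m s : (s \in incseqs n m) =
  [&& size s == m, increasing_index s & all (leq^~ n) s].
Proof.
elim: n m s => [|n IH] [|m] s; rewrite ?incseqsn0.
- by rewrite inE; case: s.
- rewrite in_nil; apply/esym/negP => /and3P[].
  case: s => [//|k s] _ /andP[/= /andP[k1 _] _] /andP[k0 _].
  by move: (leq_trans k1 k0).
- by rewrite inE; case: s.
rewrite mem_cat IH.
apply/idP/idP => [/orP[/and3P[-> -> /allP H]|/mapP[t]]|].
- by apply/allP => x /H /leqW.
- rewrite IH => /and3P[/eqP <- it /allP H] ->.
  rewrite size_rcons eqxx increasing_index_rcons it /= andbT.
  rewrite all_rcons leqnn /=; apply/andP; split; apply/allP => x /H //.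
  by move=> /leqW.
case/lastP: s => [/andP[]//|t k] /and3P[].
rewrite increasing_index_rcons size_rcons eqSS => sz /and3P[it tk k0].
rewrite all_rcons => /andP[kn _].
have [kn'|nk] := leqP k n; apply/orP.
  left; rewrite sz /= it tk k0 all_rcons kn' /=.
  by apply: sub_all tk => x xk; exact: leq_trans (ltnW xk) kn'.
right; have -> : k = n.+1 by apply/eqP; rewrite eqn_leq kn nk.
apply: map_f.
rewrite IH sz it /=; apply: sub_all tk => x xk.
by rewrite -ltnS; exact: leq_trans xk kn.
Qed.

Lemma uniq_incseqs n m : uniq (incseqs n m).
Proof.
elim: n m => [|n IH] [|m] //=; rewrite cat_uniq IH map_inj_uniq ?IH ?andbT//=.
  apply/hasPn => s /mapP[t _ ->]; rewrite mem_incseqs all_rcons ltnn /=.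
  by rewrite !andbF.
by move=> x y /rcons_inj [].
Qed.

Lemma size_incseqs n m : size (incseqs n m) = 'C(n, m).
Proof.
elim: n m => [|n IH] [|m] //=.
by rewrite size_cat size_map !IH binS.
Qed.

(** Trades the tuples of bounded ordinals that index a U-statistic for a list
    on which one can argue by induction. *)
Lemma sum_increasing_index (M : nmodType) n m (G : seq nat -> M) :
  \sum_(i : m.-tuple 'I_n.+1 | increasing_index (map val i)) G (map val i) =
  \sum_(s <- incseqs n m) G s.
Proof.
rewrite big_mkcond -big_enum -big_mkcond -big_filter.
rewrite -(big_map (fun i : m.-tuple 'I_n.+1 => map val i) xpredT) /=.
apply: perm_big; apply: uniq_perm; last 1 first.
- move=> s; rewrite mem_incseqs; apply/mapP/and3P => [[t]|[sz si sn]].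
    rewrite mem_filter mem_enum andbT => ti ->.
    rewrite size_map size_tuple; split=> //.
    by apply/allP => _ /mapP[i _ ->]; rewrite -ltnS ltn_ord.
  have sE : map val (map (@inord n) s) = s.
    rewrite -map_comp -[RHS]map_id; apply/eq_in_map => k ks /=.
    by rewrite inordK// ltnS (allP sn).
  have sz' : size (map (@inord n) s) == m by rewrite size_map.
  exists (Tuple sz'); last by rewrite /= sE.
  by rewrite mem_filter mem_enum /= sE si.
- rewrite map_inj_uniq; first by apply: filter_uniq; exact: enum_uniq.
  by move=> x y /(inj_map val_inj) /val_inj.
- exact: uniq_incseqs.
Qed.

(** The unnormalized U-statistic of a product kernel: u j k is the value of the
    j-th factor at time k. *)
Definition increasing_sum (R : pzRingType) (u : nat -> nat -> R) n m : R :=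
  \sum_(s <- incseqs n m) \prod_(j < m) u j (nth 0%N s j).

Lemma increasing_sumS (R : comPzRingType) (u : nat -> nat -> R) n m :
  increasing_sum u n m.+1 = \sum_(k < n) u m k.+1 * increasing_sum u k m.
Proof.
elim: n => [|n IH]; first by rewrite big_ord0 /increasing_sum big_nil.
rewrite big_ord_recr /= -IH /increasing_sum /= big_cat /=; congr +%R.
rewrite big_map mulr_sumr big_seq [RHS]big_seq; apply: eq_bigr => s.
rewrite mem_incseqs => /and3P[/eqP sz _ _].
rewrite big_ord_recr /= mulrC nth_rcons sz ltnn eqxx; congr *%R.
by apply: eq_bigr => i _; rewrite nth_rcons sz ltn_ord.
Qed.

Lemma increasing_sum0 (R : comPzRingType) (u : nat -> nat -> R) n :
  increasing_sum u n 0 = 1.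
Proof.
by rewrite /increasing_sum incseqsn0 big_seq1 big_ord0.
Qed.

(** * Weighted Cesaro means *)

Section cesaro.
Context (R : realType).
Implicit Types (a b x : nat -> R) (u : nat -> nat -> R) (c : nat -> R).

Lemma abel_summation (w b : nat -> R) n :
  \sum_(k < n) w k * b k = w n * (\sum_(k < n) b k) -
    \sum_(k < n) (w k.+1 - w k) * (\sum_(i < k.+1) b i).
Proof.
elim: n => [|n IH]; first by rewrite !big_ord0 mulr0 subr0.
by rewrite !big_ord_recr /= IH; ring.
Qed.

(** x n = o(n ^ m), in the form of a bound valid for every n.  With n + K in
    place of n the bound is monotone in n and in K, so it can be summed over n
    without splitting off the small indices. *)
Definition negligible_power x (m : nat) :=
  forall e : R, 0 < e -> exists K : nat, forall n : nat,
    `|x n| <= e * (n + K)%:R ^+ m.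

Lemma negligible_sumM x b m : negligible_power x m -> (forall k, `|b k| <= 1) ->
  negligible_power (fun n => \sum_(k < n) b k * x k) m.+1.
Proof.
move=> xm b1 e e0; have [K HK] := xm _ e0; exists K => n.
have step k : (k < n)%N -> `|b k * x k| <= e * (n + K)%:R ^+ m.
  move=> kn; rewrite normrM (le_trans (ler_piMl _ (b1 k)))//.
  apply: le_trans (HK k) _; rewrite ler_pM2l// lerXn2r ?nnegrE ?ler0n//.
  by rewrite ler_nat leq_add2r ltnW.
rewrite (le_trans (ler_norm_sum _ _ _))//.
apply: (@le_trans _ _ (\sum_(k < n) e * (n + K)%:R ^+ m)).
  by apply: ler_sum => k _; exact: step.
rewrite sumr_const card_ord -[leLHS]mulr_natl exprS mulrCA ler_pM2l//.
by rewrite ler_wpM2r ?exprn_ge0 ?ler_nat ?leq_addr.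
Qed.

(** Abel summation rewrites the weighted sum with the increments of w, which
    are nonnegative and add up to at most w n; each is multiplied by a partial
    sum of b, and those are o(n). *)
Lemma negligible_weighted (w b : nat -> R) m :
  {homo w : k l / (k <= l)%N >-> k <= l} ->
  (forall n, 0 <= w n <= n%:R ^+ m) ->
  negligible_power (fun n => \sum_(k < n) b k) 1 ->
  negligible_power (fun n => \sum_(k < n) w k * b k) m.+1.
Proof.
move=> wnd w0 bs e e0.
have [K HK] := bs _ (divr_gt0 e0 (ltr0n R 2)).
exists K => n; rewrite abel_summation.
have w0' k : 0 <= w k by case/andP: (w0 k).
apply: le_trans (ler_normB _ _) _.
have H1 k : (k <= n)%N -> `|\sum_(i < k) b i| <= e / 2 * (n + K)%:R.
  move=> kn; apply: le_trans (HK k) _.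
  by rewrite expr1 ler_pM2l ?divr_gt0// ler_nat leq_add2r.
have H2 : `|\sum_(k < n) (w k.+1 - w k) * \sum_(i < k.+1) b i| <=
    w n * (e / 2 * (n + K)%:R).
  apply: le_trans (ler_norm_sum _ _ _) _.
  apply: (@le_trans _ _ (\sum_(k < n) (w k.+1 - w k) * (e / 2 * (n + K)%:R))).
    apply: ler_sum => k _; have wk : 0 <= w k.+1 - w k by rewrite subr_ge0 wnd.
    by rewrite normrM (ger0_norm wk) ler_wpM2l// H1.
  rewrite -mulr_suml ler_wpM2r ?mulr_ge0 ?divr_ge0 ?ler0n ?(ltW e0)//.
  rewrite -(big_mkord xpredT (fun k => w k.+1 - w k)) telescope_sumr//.
  by rewrite gerBl.
rewrite normrM (ger0_norm (w0' _)).
apply: (@le_trans _ _ (w n * (e * (n + K)%:R))).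
  have -> : w n * (e * (n + K)%:R) =
    w n * (e / 2 * (n + K)%:R) + w n * (e / 2 * (n + K)%:R) by field.
  by rewrite lerD// ler_wpM2l// H1.
rewrite mulrCA ler_pM2l// exprSr ler_wpM2r ?ler0n//.
case/andP: (w0 n) => _ /le_trans; apply.
by rewrite lerXn2r ?nnegrE ?ler0n// ler_nat leq_addr.
Qed.

Lemma negligible_powerD x b m : negligible_power x m -> negligible_power b m ->
  negligible_power (x \+ b) m.
Proof.
move=> xm bm e e0; have e2 : 0 < e / 2 by rewrite divr_gt0.
have [K HK] := xm _ e2; have [L HL] := bm _ e2.
exists (maxn K L) => n /=; apply: le_trans (ler_normD _ _) _.
rewrite [e in leRHS]splitr mulrDl lerD//.
  apply: le_trans (HK n) _; rewrite ler_pM2l// lerXn2r ?nnegrE ?ler0n//.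
  by rewrite ler_nat leq_add2l leq_maxl.
apply: le_trans (HL n) _; rewrite ler_pM2l// lerXn2r ?nnegrE ?ler0n//.
by rewrite ler_nat leq_add2l leq_maxr.
Qed.

Lemma negligible_powerZ x m (t : R) : `|t| <= 1 -> negligible_power x m ->
  negligible_power (fun n => t * x n) m.
Proof.
move=> t1 xm e e0; have [K HK] := xm _ e0; exists K => n.
by rewrite normrM (le_trans (ler_piMl _ t1)).
Qed.

Lemma sum_bin n m : (\sum_(k < n) 'C(k, m) = 'C(n, m.+1))%N.
Proof.
elim: n => [|n IH]; first by rewrite big_ord0 bin0n.
by rewrite big_ord_recr /= IH binS addnC.
Qed.

Lemma leq_bin_exp n m : ('C(n, m) <= n ^ m)%N.
Proof.
elim: m n => [|m IH] n; first by rewrite bin0.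
rewrite -sum_bin expnS -[X in (X * _)%N]card_ord -sum_nat_const.
apply: leq_sum => k _; apply: leq_trans (IH n).
by rewrite leq_bin2l// ltnW.
Qed.

Lemma leq_exp_bin n m : (m.*2 <= n)%N -> (n ^ m <= 2 ^ m * m`! * 'C(n, m))%N.
Proof.
move=> mn; rewrite -mulnA [(m`! * _)%N]mulnC bin_ffact ffact_prod.
rewrite -[X in (_ ^ X <= _)%N]card_ord -[X in (2 ^ X)%N]card_ord.
rewrite -!prod_nat_const -big_split /=.
by apply: leq_prod => i _; have := ltn_ord i; lia.
Qed.

(** Induction on m.  In sum_k u_m(k+1) S_m(k), replacing S_m(k) by its
    approximation 'C(k, m) prod_(j < m) c_j costs o(n ^ m.+1), and what remains
    is a Cesaro sum of u_m - c_m with the increasing weights 'C(k, m). *)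
Lemma increasing_sum_negligible u c m :
  (forall j k, `|u j k| <= 1) -> (forall j, `|c j| <= 1) ->
  (forall j, negligible_power (fun n => \sum_(k < n) (u j k.+1 - c j)) 1) ->
  negligible_power
    (fun n => increasing_sum u n m - 'C(n, m)%:R * \prod_(j < m) c j) m.
Proof.
move=> u1 c1 uc; elim: m => [|m IH].
  move=> e e0; exists 0%N => n.
  by rewrite increasing_sum0 bin0 big_ord0 mulr1 subrr normr0 mulr_ge0 ?ltW.
have prod1 : `|\prod_(j < m) c j| <= 1.
  by rewrite normr_prod prodr_ile1// => i _; rewrite normr_ge0 c1.
rewrite (_ : (fun n => _) = (fun n => \sum_(k < n) u m k.+1 *
    (increasing_sum u k m - 'C(k, m)%:R * \prod_(j < m) c j)) \+
    (fun n => (\prod_(j < m) c j) *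
       \sum_(k < n) ('C(k, m)%:R * (u m k.+1 - c m)))).
  apply: negligible_powerD.
    by apply: (@negligible_sumM (fun k =>
      increasing_sum u k m - 'C(k, m)%:R * \prod_(j < m) c j)
      (fun k => u m k.+1)).
  apply: negligible_powerZ => //.
  apply: (@negligible_weighted (fun k => 'C(k, m)%:R)
    (fun k => u m k.+1 - c m)) => //.
    by move=> k l kl /=; rewrite ler_nat leq_bin2l.
  by move=> n; rewrite ler0n -natrX ler_nat leq_bin_exp.
apply/funext => n /=; rewrite increasing_sumS big_ord_recr /= -sum_bin natr_sum.
rewrite mulr_suml mulr_sumr -sumrB -big_split /=; apply: eq_bigr => k _.
by ring.
Qed.

Theorem cvg_increasing_sum u c m :
  (forall j k, `|u j k| <= 1) -> (forall j, `|c j| <= 1) ->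
  (forall j, negligible_power (fun n => \sum_(k < n) (u j k.+1 - c j)) 1) ->
  (fun n => 'C(n, m)%:R^-1 * increasing_sum u n m) @ \oo -->
    \prod_(j < m) c j.
Proof.
move=> u1 c1 neg; apply/cvgrPdist_le => e e0.
(* For n >= 2m and n >= K one has (n + K) ^ m <= 2 ^ m n ^ m and
   n ^ m <= 2 ^ m m! 'C(n, m), which explains the constant B. *)
pose B : R := (2 ^ m * m`! * 2 ^ m)%:R.
have B0 : 0 < B by rewrite ltr0n !muln_gt0 fact_gt0 !expn_gt0.
have [K HK] := increasing_sum_negligible m u1 c1 neg (divr_gt0 e0 B0).
exists (maxn m.*2 K) => // n /=; rewrite geq_max => /andP[mn Kn].
have Cn : (0 : R) < 'C(n, m)%:R.
  by rewrite ltr0n bin_gt0; apply: leq_trans mn; rewrite -addnn leq_addr.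
rewrite distrC -(ler_pM2l Cn) -[X in X * `|_|](ger0_norm (ltW Cn)) -normrM.
rewrite mulrBr mulVKf ?gt_eqF//; apply: le_trans (HK n) _.
rewrite mulrAC ler_pdivrMr// [_ * e]mulrC -mulrA ler_pM2l//.
rewrite -natrX -natrM ler_nat.
apply: (@leq_trans ((2 * n) ^ m)); first by case: {+}m => // k; rewrite leq_exp2r//; lia.
rewrite expnMn; apply: leq_trans (leq_mul (leqnn _) (leq_exp_bin mn)) _.
by rewrite eq_leq//; ring.
Qed.

End cesaro.

(** * Birkhoff's ergodic theorem for bounded observables *)

Section ergodic.
Context d (Omega : measurableType d) (R : realType) (P : probability Omega R).
Variable T : Omega -> Omega.
Hypothesis mT : measurable_fun setT T.
Hypothesis PT : forall A, measurable A -> P (T @^-1` A) = P A.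
Implicit Types (f : Omega -> R) (D : set Omega).

Definition bounded_mfun f :=
  measurable_fun setT f /\ exists M, forall w, `|f w| <= M.

Lemma bounded_mfun_integrable f : bounded_mfun f ->
  P.-integrable setT (EFin \o f).
Proof.
move=> [mf [M fM]]; apply: measurable_bounded_integrable => //.
  exact: (le_lt_trans (probability_le1 P measurableT) (ltry 1)).
exists M; split; first exact: num_real.
by move=> x Mx w _; apply: le_trans (fM w) (ltW Mx).
Qed.

Lemma Rintegral_preserved f : bounded_mfun f ->
  \int[P]_w f (T w) = \int[P]_w f w.
Proof.
move=> [mf [M fM]]; rewrite /Rintegral; congr fine.
have bfT : bounded_mfun (f \o T).
  by split; [exact: measurableT_comp|exists M => w; exact: fM].
rewrite -[LHS](@integral_pushforward _ _ _ _ _ T mT P setT (EFin \o f))//.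
- apply: eq_measure_integral => A mA _; exact: PT.
- exact/measurable_EFinP.
- exact: bounded_mfun_integrable.
Qed.

(** The maximum of the partial sums S_0 f w, ..., S_n f w.  The recursion comes
    from S_(k+1) f w = f w + S_k f (T w) and makes the maximal inequality
    immediate. *)
Fixpoint running_max f n (w : Omega) : R :=
  if n is n'.+1 then Num.max 0 (f w + running_max f n' (T w)) else 0.

Definition birkhoff_sum f n w := \sum_(k < n) f (iter k T w).

Lemma birkhoff_sumS f n w :
  birkhoff_sum f n.+1 w = f w + birkhoff_sum f n (T w).
Proof.
rewrite /birkhoff_sum big_ord_recl; congr +%R.
by apply: eq_bigr => i _; rewrite -iterSr.
Qed.

Lemma measurable_iter n : measurable_fun setT (iter n T).
Proof.
elim: n => [|n IH]; [exact: measurable_id|exact: (measurableT_comp mT IH)].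
Qed.

Lemma measurable_birkhoff_sum f n : measurable_fun setT f ->
  measurable_fun setT (birkhoff_sum f n).
Proof.
move=> mf; apply: measurable_sum => k.
exact: (measurableT_comp mf (measurable_iter k)).
Qed.

Lemma running_max_ge0 f n w : 0 <= running_max f n w.
Proof. by case: n => //= n; rewrite le_max lexx. Qed.

Lemma le_running_max f n w : birkhoff_sum f n w <= running_max f n w.
Proof.
elim: n w => [|n IH] w; first by rewrite /birkhoff_sum big_ord0.
by rewrite birkhoff_sumS /= le_max lerD2l IH orbT.
Qed.

Lemma running_max_nd f n w : running_max f n w <= running_max f n.+1 w.
Proof.
elim: n w => [|n IH] w; first exact: running_max_ge0.
rewrite /= ge_max le_max lexx /= le_max; apply/orP; right.
by rewrite lerD2l; exact: IH.
Qed.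

Lemma bounded_running_max f n : bounded_mfun f -> bounded_mfun (running_max f n).
Proof.
move=> [mf [M fM]]; split.
  elim: n => [|n IH] //=; apply: measurable_maxr => //.
  by apply: measurable_funD => //; exact: measurableT_comp.
exists (M *+ n) => w; elim: n w => [|n IH] w /=; first by rewrite normr0.
have M0 : 0 <= M by apply: le_trans (fM w).
rewrite ger0_norm ?le_max ?lexx// ge_max mulrn_wge0//= mulrS lerD//.
  exact: le_trans (ler_norm _) (fM w).
exact: le_trans (ler_norm _) (IH _).
Qed.

(** Where the running maximum M_n is positive it equals f + M_(n-1) o T, hence
    is at most f + M_n o T; elsewhere M_n vanishes and M_n o T is
    nonnegative. *)
Lemma running_max_drop f n w :
  running_max f n w - running_max f n (T w) <=
  f w * (0 < running_max f n w)%R%:R.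
Proof.
case: n => [|n]; first by rewrite /= ltxx mulr0 subrr.
have [gt0|le0] := ltP 0 (running_max f n.+1 w).
  rewrite mulr1 lerBlDr; apply: (@le_trans _ _ (f w + running_max f n (T w))).
    by move: gt0; rewrite /= lt_max ltxx /= => /ltW gt0; rewrite ge_max gt0/=.
  by rewrite lerD2l running_max_nd.
by rewrite mulr0 subr_le0 (le_trans le0)// running_max_ge0.
Qed.

(** Garsia's argument: integrating the previous inequality gives
    0 <= E[f ; M_n > 0], because M_n and M_n o T have the same integral.  Cutting
    f off outside D, which is legitimate because D is invariant, makes the
    events M_n > 0 increase to D. *)
Lemma maximal_ergodic_ineq f D : bounded_mfun f -> measurable D ->
  T @^-1` D = D -> (forall w, D w -> exists n, 0 < birkhoff_sum f n w) ->
  0 <= \int[P]_w (f w * \1_D w).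
Proof.
move=> bf mD TD Dpos; pose g w := f w * \1_D w.
have bg : bounded_mfun g.
  have [mf [M fM]] := bf; split.
    by apply: measurable_funM => //; exact: measurable_indic.
  exists M => w; rewrite normrM (le_trans _ (fM w))// ler_piMr//.
  by rewrite indicE; case: (_ \in _); rewrite ?normr1 ?normr0.
have DT w : D (T w) <-> D w by rewrite -[X in _ <-> X w]TD.
have sum_g n w : D w -> birkhoff_sum g n w = birkhoff_sum f n w.
  elim: n w => [|n IH] w Dw; first by rewrite /birkhoff_sum !big_ord0.
  by rewrite !birkhoff_sumS IH ?DT// /g indicE mem_set// mulr1.
pose gn n w := g w * (0 < running_max g n w)%R%:R.
have mgn n : measurable_fun setT (gn n).
  apply: measurable_funM; first by case: bg.
  have [mM _] := bounded_running_max n bg.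
  rewrite (_ : (fun w => _) = \1_(running_max g n @^-1` `]0, +oo[)).
    apply: measurable_indic; rewrite -[X in measurable X]setTI.
    by apply: mM => //; exact: measurable_itv.
  apply/funext => w; rewrite indicE; congr (nat_of_bool _)%:R.
  by apply/idP/idP; rewrite in_setE /= in_itv /= andbT.
have gn_le n w : `|gn n w| <= `|g w|.
  by rewrite normrM ler_piMr//; case: (_ < _); rewrite ?normr1 ?normr0.
have bgn n : bounded_mfun (gn n).
  split=> //; have [_ [M gM]] := bg; exists M => w.
  exact: le_trans (gn_le _ _) (gM w).
have gn_ge0 n : 0 <= \int[P]_w gn n w.
  have bM := bounded_running_max n bg.
  have bMT : bounded_mfun (running_max g n \o T).
    have [mM [K MK]] := bM.
    by split; [exact: measurableT_comp|exists K => w; exact: MK].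
  have IM := bounded_mfun_integrable bM.
  have IMT := bounded_mfun_integrable bMT.
  rewrite -(subrr (\int[P]_w running_max g n w)).
  rewrite -{2}(Rintegral_preserved bM) -RintegralB//.
  apply: le_Rintegral => //.
  - exact: (integrableB _ IM IMT).
  - exact: bounded_mfun_integrable.
  - by move=> w _; exact: running_max_drop.
have cvg_gn w : gn ^~ w @ \oo --> g w.
  have [Dw|nDw] := pselect (D w); last first.
    have -> : gn ^~ w = cst 0.
      by apply/funext => n; rewrite /gn /g indicE memNset// mulr0 mul0r.
    by rewrite /g indicE memNset// mulr0; exact: cvg_cst.
  have [n0 Sn0] := Dpos _ Dw.
  apply: cvg_near_cst; exists n0 => // n /= n0n; rewrite /gn.
  suff -> : 0 < running_max g n w by rewrite mulr1.
  apply: (@lt_le_trans _ _ (running_max g n0 w)).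
    by apply: lt_le_trans (le_running_max _ _ _); rewrite sum_g.
  have := @homo_leq _ (running_max g ^~ w) <=%R.
  by apply=> //; [exact: le_trans|move=> k; exact: running_max_nd].
have [] := @dominated_convergence _ _ _ P setT measurableT
  (fun n => EFin \o gn n) (EFin \o g) (fun w => `|g w|%:E).
- by move=> n; exact/measurable_EFinP.
- by apply/measurable_EFinP; case: bg.
- apply: aeW => w _; apply/fine_cvgP; split; first exact: nearW.
  exact: cvg_gn.
- exact: (integrable_norm (bounded_mfun_integrable bg)).
- by apply: aeW => w n _; rewrite /= lee_fin gn_le.
move=> _ _ cvgI; rewrite /Rintegral; apply: fine_ge0.
apply: (cvge_to_ge cvgI); apply: nearW => n /=.
have := gn_ge0 n; rewrite /Rintegral -lee_fin fineK//.
exact: integrable_fin_num (bounded_mfun_integrable (bgn n)).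
Qed.

(** Let D be the event that the sums S_n (f - e) are unbounded above.  Changing
    the starting point from w to T w shifts these sums by a bounded amount, so
    D is exactly invariant and not merely up to a null set.  The maximal
    inequality on D gives 0 <= E[f ; D] - e P(D) = - e P(D). *)
Lemma birkhoff_upper f e : bounded_mfun f ->
  (forall E, invariant_sets T E -> \int[P]_w (f w * \1_E w) = 0) -> 0 < e ->
  {ae P, forall w, exists N : nat, forall n, birkhoff_sum f n w <= e * (n + N)%:R}.
Proof.
move=> bf f0 e0; pose F w := f w - e.
pose D := \bigcap_N \bigcup_n [set w | N%:R < birkhoff_sum F n w].
have [mf [M fM]] := bf.
have bF : bounded_mfun F.
  split; first exact: measurable_funB.
  by exists (M + `|e|) => w; rewrite (le_trans (ler_normB _ _))// lerD.
have mD : measurable D.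
  apply: bigcapT_measurable => N; apply: bigcupT_measurable => n.
  rewrite (_ : [set w | _] = birkhoff_sum F n @^-1` `]N%:R, +oo[).
    rewrite -[X in measurable X]setTI.
    by apply: measurable_birkhoff_sum => //; case: bF.
  by apply/seteqP; split=> w /=; rewrite in_itv /= andbT.
have TD : T @^-1` D = D.
  have [_ [K FK]] := bF.
  have [k /ltW Kk] : exists k : nat, K < k%:R.
    by exists (Num.truncn K).+1; exact: truncnS_gt.
  apply/seteqP; split=> w Dw N _.
    have [n _ /= Hn] := Dw (N + k)%N I; exists n.+1 => //=.
    have := FK w; rewrite ler_norml => /andP[FKw _].
    rewrite birkhoff_sumS; rewrite natrD in Hn; lra.
  have [[|n] _ /= Hn] := Dw (N + k)%N I.
    by move: Hn; rewrite /birkhoff_sum big_ord0 ltrn0.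
  exists n => //=; have := FK w; rewrite ler_norml => /andP[_ FKw].
  rewrite birkhoff_sumS natrD in Hn; lra.
have ID : bounded_mfun (\1_D : _ -> R).
  split; first exact: measurable_indic.
  by exists 1 => w; rewrite indicE; case: (_ \in _); rewrite ?normr1 ?normr0.
have PD : P D = 0%E.
  have : 0 <= \int[P]_w (F w * \1_D w).
    apply: maximal_ergodic_ineq => // w Dw.
    by have [n _ /= Hn] := Dw 0%N I; exists n.
  rewrite (_ : (fun w => _) = fun w => f w * \1_D w - e * \1_D w); last first.
    by apply/funext => w; rewrite /F mulrBl.
  rewrite RintegralB//.
  - rewrite f0// RintegralZl//; last exact: bounded_mfun_integrable.
    rewrite sub0r oppr_ge0 pmulr_rle0// /Rintegral => H.
    have : (\int[P]_w (\1_D w)%:E = P D)%E by rewrite integral_indic// setIT.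
    move=> PDE; move: H; rewrite PDE => H.
    have PDf : P D \is a fin_num by exact: fin_num_measure.
    apply/eqP; rewrite eq_le measure_ge0 andbT -(fineK PDf) lee_fin//.
  - apply: bounded_mfun_integrable; split; first exact: measurable_funM (ID.1).
    exists M => w; rewrite normrM (le_trans _ (fM w))// ler_piMr//.
    by rewrite indicE; case: (_ \in _); rewrite ?normr1 ?normr0.
  - by apply: (integrableZl measurableT e (bounded_mfun_integrable ID)).
exists D; split=> // w /= nH; apply: contrapT => nD; apply: nH.
have [N HN] : exists N : nat, forall n, birkhoff_sum F n w <= N%:R.
  apply: contrapT => /forallNP H; apply: nD => N _.
  have /existsNP[n /negP] := H N; rewrite -ltNge => Hn; by exists n.
have [K /ltW HK] : exists K : nat, N%:R / e < K%:R.
  by exists (Num.truncn (N%:R / e)).+1; exact: truncnS_gt.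
exists K => n; have := HN n; rewrite /birkhoff_sum /F sumrB sumr_const card_ord.
rewrite ler_pdivrMr// in HK.
rewrite -[e *+ n]mulr_natr natrD; lra.
Qed.

(** The limit is 0 because the hypothesis says that f has a vanishing
    conditional expectation given the invariant sets. *)
Theorem birkhoff f : bounded_mfun f ->
  (forall E, invariant_sets T E -> \int[P]_w (f w * \1_E w) = 0) ->
  {ae P, forall w, negligible_power (birkhoff_sum f ^~ w) 1}.
Proof.
move=> bf f0; have [mf [M fM]] := bf.
pose e k : R := k.+1%:R^-1.
have bNf : bounded_mfun (fun w => - f w).
  split; first exact: measurable_funN.
  by exists M => w; rewrite normrN.
have ek0 k : 0 < e k by rewrite invr_gt0.
have up k := birkhoff_upper bf f0 (ek0 k).
have lo k : {ae P, forall w, exists N : nat, forall n,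
    birkhoff_sum (fun w => - f w) n w <= e k * (n + N)%:R}.
  apply: birkhoff_upper => //.
  move=> E IE; under eq_Rintegral do rewrite mulNr -mulN1r.
  have [mE _] := IE; rewrite RintegralZl// ?f0 ?mulr0//.
  apply: bounded_mfun_integrable; split.
    by apply: measurable_funM => //; exact: measurable_indic.
  exists M => w; rewrite normrM (le_trans _ (fM w))// ler_piMr//.
  by rewrite indicE; case: (_ \in _); rewrite ?normr1 ?normr0.
have : {ae P, forall w, forall k, (exists N : nat, forall n,
    birkhoff_sum f n w <= e k * (n + N)%:R) /\ (exists N : nat, forall n,
    birkhoff_sum (fun w => - f w) n w <= e k * (n + N)%:R)}.
  by apply: ae_foralln => k; apply: filterS2 (up k) (lo k).
apply: filterS => w H eps eps0.
have [k ke] : exists k, e k <= eps.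
  exists (Num.truncn eps^-1); rewrite /e -[leRHS]invrK lef_pV2 ?posrE ?invr_gt0//.
  exact/ltW/truncnS_gt.
have [[N HN] [K HK]] := H k; exists (maxn N K) => n.
rewrite expr1 ler_norml; apply/andP; split.
  rewrite lerNl -sumrN (le_trans (HK n))// ler_pM// ?invr_ge0//.
  by rewrite ler_nat leq_add2l leq_maxr.
rewrite (le_trans (HN n))// ler_pM// ?invr_ge0//.
by rewrite ler_nat leq_add2l leq_maxl.
Qed.

End ergodic.

(** * Inequalities for p-th powers and for integrals *)

Section nonneg_limits.
Context (R : realType) (I : Type) (F : set_system I) (FF : Filter F).
Local Open Scope ereal_scope.

Lemma cvge_0P (u : I -> \bar R) : (forall n, 0 <= u n) ->
  (u @ F --> 0) <-> (forall e : R, (0 < e)%R -> \forall n \near F, u n <= e%:E).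
Proof.
move=> u0; split=> [/fine_cvgP[ufin uc] e e0|H].
  move/cvgrPdist_le : uc => /(_ _ e0); apply: filterS2 ufin => n un.
  by rewrite sub0r normrN -lee_fin /= -abse_EFin fineK// gee0_abs.
apply/fine_cvgP; split.
  apply: filterS (H _ ltr01) => n un1.
  by rewrite ge0_fin_numE// (le_lt_trans un1)// ltry.
apply/cvgrPdist_le => e e0; apply: filterS (H _ e0) => n une.
rewrite sub0r normrN ger0_norm ?fine_ge0// -lee_fin fineK//.
by rewrite ge0_fin_numE// (le_lt_trans une)// ltry.
Qed.

End nonneg_limits.

Section power_inequalities.
Context (R : realType) (p : R).
Hypothesis p1 : 1 <= p.
Implicit Types a b c t : R.

Let p0 : 0 < p. Proof. exact: lt_le_trans p1. Qed.

(** The tangent line at t to the convex function x ^ p lies below its graph;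
    this is Young's inequality with the exponents p and p / (p - 1).  Averaging
    it in x, with t the mean, gives both forms of Jensen's inequality below. *)
Lemma powR_tangent t (x : R) : 0 <= t -> 0 <= x ->
  p * (t `^ (p - 1) * x) <= x `^ p + (p - 1) * t `^ p.
Proof.
move=> t0 x0; have [->|pn1] := eqVneq p 1.
  by rewrite subrr powRr0 mul0r addr0 !mul1r powRr1.
have p1' : 0 < p - 1 by rewrite subr_gt0 lt_neqAle eq_sym pn1.
have pE : t `^ (p - 1) `^ (p / (p - 1)) = t `^ p.
  by rewrite -powRrM mulrCA divff ?gt_eqF// mulr1.
have := @conjugate_powR _ x (t `^ (p - 1)) p (p / (p - 1)) x0 (powR_ge0 _ _) p0
  (divr_gt0 p0 p1').
rewrite pE => H.
have -> : x `^ p + (p - 1) * t `^ p =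
    p * (x `^ p / p + t `^ p / (p / (p - 1))).
  by field; rewrite !gt_eqF.
rewrite ler_pM2l// mulrC; apply: H.
by field; rewrite !gt_eqF.
Qed.

Lemma ler_add1_powR (x : R) : 0 <= x -> x <= 1 + x `^ p.
Proof.
move=> x0; have [x1|x1] := leP x 1.
  by rewrite (le_trans x1)// lerDl powR_ge0.
rewrite (@le_trans _ _ (x `^ p))// ?lerDr//.
by rewrite -[leLHS]powRr1// ler_powR// ltW.
Qed.

Lemma powR_le_sum3 (x : R) a b c : 0 <= x -> 0 <= a -> 0 <= b -> 0 <= c ->
  x <= a + b + c -> x `^ p <= 3 `^ p * (a `^ p + b `^ p + c `^ p).
Proof.
move=> x0 a0 b0 c0 xabc.
pose M := Num.max a (Num.max b c).
have [aM bM cM] : [/\ a <= M, b <= M & c <= M].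
  by rewrite /M !le_max !lexx !orbT.
have M0 : 0 <= M := le_trans a0 aM.
apply: (@le_trans _ _ ((3 * M) `^ p)).
  rewrite ge0_ler_powR ?nnegrE ?mulr_ge0 ?(ltW p0)//.
  by apply: le_trans xabc _; lra.
rewrite powRM// ler_wpM2l ?powR_ge0//.
have := powR_ge0 a p; have := powR_ge0 b p; have := powR_ge0 c p.
have [->|[->|->]] : M = a \/ M = b \/ M = c; try lra.
by rewrite /M /Num.max; case: ifP; case: ifP; auto.
Qed.

Lemma powR_mean (I : finType) (Q : pred I) (a : I -> R) (N : R) :
  0 < N -> \sum_(i | Q i) 1 = N ->
  `|N^-1 * \sum_(i | Q i) a i| `^ p <= N^-1 * \sum_(i | Q i) `|a i| `^ p.
Proof.
move=> N0 QN; set t := `|_|.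
have t0 : 0 <= t by exact: normr_ge0.
have tle : N * t <= \sum_(i | Q i) `|a i|.
  rewrite /t normrM ger0_norm ?invr_ge0 ?(ltW N0)// mulVKf ?gt_eqF//.
  exact: ler_norm_sum.
rewrite -(ler_pM2l N0) mulVKf ?gt_eqF//.
have : \sum_(i | Q i) p * (t `^ (p - 1) * `|a i|) <=
    \sum_(i | Q i) (`|a i| `^ p + (p - 1) * t `^ p * 1).
  by apply: ler_sum => i _; rewrite mulr1 powR_tangent.
rewrite big_split /= -!mulr_sumr QN.
have tp : t `^ p = t * t `^ (p - 1) by rewrite mulr_powRB1.
move=> H; rewrite -(lerD2r ((p - 1) * t `^ p * N)) (le_trans _ H)//.
apply: (@le_trans _ _ (p * (t `^ (p - 1) * (N * t)))).
  by rewrite tp le_eqVlt; apply/orP; left; apply/eqP; ring.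
by rewrite ler_wpM2l ?(ltW p0)// ler_wpM2l ?powR_ge0.
Qed.

Section integral.
Context d (V : measurableType d) (nu : {measure set V -> \bar R}).
Hypothesis nu1 : nu setT = 1%E.

Lemma powR_integrable (g : V -> R) : measurable_fun setT g ->
  (\int[nu]_x (`|g x| `^ p)%:E < +oo)%E -> nu.-integrable setT (EFin \o g).
Proof.
move=> mg gp; have mgp : measurable_fun setT (fun x => (`|g x| `^ p)%:E).
  apply/measurable_EFinP; apply: (measurableT_comp (measurable_powR p)).
  exact: measurableT_comp.
apply/integrableP; split; first exact/measurable_EFinP.
apply: (@le_lt_trans _ _ (\int[nu]_x (1 + (`|g x| `^ p)%:E))%E).
  apply: ge0_le_integral => //.
  - by apply: measurableT_comp => //; exact/measurable_EFinP.
  - exact: emeasurable_funD.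
  - by move=> x _; rewrite /= -EFinD lee_fin ler_add1_powR.
rewrite ge0_integralD//.
by rewrite integral_cst// mul1e nu1 lte_add_pinfty// ltry.
Qed.

Lemma powR_Rintegral (g : V -> R) : measurable_fun setT g ->
  (\int[nu]_x (`|g x| `^ p)%:E < +oo)%E ->
  ((`|\int[nu]_x g x| `^ p)%:E <= \int[nu]_x (`|g x| `^ p)%:E)%E.
Proof.
move=> mg gp; have ig := powR_integrable mg gp.
have ig' := integrable_norm ig.
pose t := \int[nu]_x `|g x|.
have t0 : 0 <= t by apply: Rintegral_ge0.
have igp : nu.-integrable setT (EFin \o (fun x => `|g x| `^ p)).
  apply/integrableP; split.
    apply/measurable_EFinP; apply: (measurableT_comp (measurable_powR p)).
    exact: measurableT_comp.
  by under eq_integral do rewrite /= ger0_norm ?powR_ge0//.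
have igpf := integrable_fin_num measurableT igp.
rewrite -(fineK igpf) lee_fin (@le_trans _ _ (t `^ p))//.
  rewrite ge0_ler_powR ?nnegrE ?(ltW p0)//.
  exact: le_normr_Rintegral.
have icst c : nu.-integrable setT (EFin \o (fun=> c)).
  apply: measurable_bounded_integrable => //; first by rewrite nu1 ltry.
  by exists `|c|; split=> [|M cM x _]; [exact: num_real|exact: ltW].
have i1 : nu.-integrable setT (EFin \o (fun x => p * t `^ (p - 1) * `|g x|)).
  exact: (integrableZl measurableT _ ig').
have i2 : nu.-integrable setT
    (EFin \o (fun x => `|g x| `^ p + (p - 1) * t `^ p)).
  exact: (integrableD measurableT igp (icst _)).
have := le_Rintegral measurableT i1 i2; rewrite RintegralZl// RintegralD//.
rewrite Rintegral_cst// nu1 /= mulr1 -/t => H.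
have tp : t `^ p = t * t `^ (p - 1) by rewrite mulr_powRB1.
rewrite -(lerD2r ((p - 1) * t `^ p)); apply: le_trans (H _).
  by rewrite tp le_eqVlt; apply/orP; left; apply/eqP; ring.
by move=> x _; rewrite -mulrA powR_tangent.
Qed.

End integral.
End power_inequalities.

(** The staircase adds a step of height e at each multiple of e below y, so it
    is y rounded down to a multiple of e. *)
Lemma staircase_approx (R : realType) (e y : R) N :
  0 <= e -> 0 <= y <= e * N%:R ->
  0 <= y - \sum_(j < N) e * (e * j.+1%:R <= y)%R%:R <= e.
Proof.
move=> e0; elim: N => [|N IH] /andP[y0 yN].
  by move: yN; rewrite mulr0 big_ord0 subr0 y0 => /le_trans; exact.
rewrite big_ord_recr /=; have [yN'|yN'] := leP y (e * N%:R).
  have := IH; rewrite y0 yN' => /(_ isT).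
  have [Ny|_] := leP (e * N.+1%:R) y; last by rewrite mulr0 addr0.
  have : e * N.+1%:R <= e * N%:R by exact: le_trans Ny yN'.
  rewrite -natr1 mulrDr mulr1 gerDl => e0'.
  have -> : e = 0 by apply/eqP; rewrite eq_le e0 e0'.
  by rewrite addr0.
have -> : \sum_(j < N) e * (e * j.+1%:R <= y)%R%:R = e * N%:R.
  transitivity (\sum_(j < N) e); last by rewrite sumr_const card_ord mulr_natr.
  apply: eq_bigr => j _.
  suff -> : e * j.+1%:R <= y by rewrite mulr1.
  by rewrite (le_trans _ (ltW yN'))// ler_wpM2l// ler_nat.
rewrite -natr1 mulrDr mulr1 in yN *.
by have [Ny|Ny] := leP (e * N%:R + e) y; rewrite ?mulr1 ?mulr0; apply/andP;
  split; lra.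
Qed.

Lemma ae_le_integral3 d (S : measurableType d) (R : realType)
    (nu : {measure set S -> \bar R}) (F f1 f2 f3 : S -> \bar R) (c1 c2 c3 : R) :
  0 <= c1 -> 0 <= c2 -> 0 <= c3 ->
  measurable_fun setT F -> measurable_fun setT f1 ->
  measurable_fun setT f2 -> measurable_fun setT f3 ->
  (forall x, 0 <= F x)%E -> (forall x, 0 <= f1 x)%E ->
  (forall x, 0 <= f2 x)%E -> (forall x, 0 <= f3 x)%E ->
  {ae nu, forall x, (F x <= c1%:E * f1 x + c2%:E * f2 x + c3%:E * f3 x)%E} ->
  (\int[nu]_x F x <= c1%:E * \int[nu]_x f1 x + c2%:E * \int[nu]_x f2 x +
    c3%:E * \int[nu]_x f3 x)%E.
Proof.
move=> c10 c20 c30 mF mf1 mf2 mf3 F0 f10 f20 f30 Fle.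
have ge0 (c : R) (f : S -> \bar R) : 0 <= c -> (forall x, 0 <= f x)%E ->
    forall x, (0 <= c%:E * f x)%E.
  by move=> c0 f0 x; rewrite mule_ge0.
have mZ (c : R) (f : S -> \bar R) : measurable_fun setT f ->
    measurable_fun setT (fun x => c%:E * f x)%E.
  by move=> mf; exact: emeasurable_funM.
rewrite -!ge0_integralZl_EFin// -ge0_integralD//; try by move=> x _; exact: ge0.
- rewrite -ge0_integralD//.
  + apply: ae_ge0_le_integral => //.
    * by move=> x _; rewrite !adde_ge0 ?ge0.
    * by apply: emeasurable_funD; [apply: emeasurable_funD|]; exact: mZ.
    * by apply: filterS Fle => x Fx _.
  + by move=> x _; rewrite adde_ge0 ?ge0.
  + by apply: emeasurable_funD; exact: mZ.
  + by move=> x _; exact: ge0.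
  + exact: mZ.
- exact: mZ.
- exact: mZ.
Qed.

(** * Boxes and powers of a measure *)

Section boxes.
Context d (V : measurableType d) (m : nat).
Implicit Types (C : set (set (m.-tuple V))).

Definition box (A : 'I_m -> set V) : set (m.-tuple V) := [set t | forall i, A i (tnth t i)].

Lemma measurable_box (A : 'I_m -> set V) : (forall i, measurable (A i)) -> measurable (box A).
Proof.
move=> mA; rewrite (_ : box A =
    \bigcap_(i in [set: 'I_m]) (@tnth m V ^~ i @^-1` A i)).
  apply: fin_bigcap_measurable => // i _.
  by rewrite -[X in measurable X]setTI; exact: measurable_tnth.
by apply/seteqP; split=> t /= H i; [move=> _; exact: H|exact: (H i I)].
Qed.

(** The pi-lambda theorem for the sigma-algebra on tuples, which is generated by
    the boxes; boxes are stable under intersection. *)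
Lemma box_ind C :
  (forall A : 'I_m -> set V, (forall i, measurable (A i)) -> C (box A)) ->
  (forall A B, measurable A -> measurable B -> B `<=` A -> C A -> C B ->
    C (A `\` B)) ->
  (forall F, (forall n, measurable (F n)) -> nondecreasing_seq F ->
    (forall n, C (F n)) -> C (\bigcup_n F n)) ->
  forall A, measurable A -> C A.
Proof.
move=> Cbox CD Cnd A mA.
pose boxes := [set box B | B in [set B | forall i, measurable (B i)]].
pose H := [set B | measurable B /\ C B].
suff [] : H A by [].
have boxH : <<s boxes>> `<=` H.
  apply: lambda_system_subset => //.
  - move=> _ _ [A1 mA1 <-] [A2 mA2 <-]; exists (fun i => A1 i `&` A2 i).
      by move=> i; exact: measurableI.
    apply/seteqP; split=> t /= => [At|[At Bt] i]; last by split.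
    by split=> i; case: (At i).
  - split=> //.
    + split=> //; rewrite (_ : setT = box (fun=> setT)); last exact/seteqP.
      exact: Cbox.
    + move=> A1 A2 A21 [mA1 CA1] [mA2 CA2]; split; first exact: measurableD.
      exact: CD.
    + move=> F ndF HF; split; last by apply: Cnd => // n; case: (HF n).
      by apply: bigcupT_measurable => n; case: (HF n).
  - by move=> _ [A1 mA1 <-]; split; [exact: measurable_box|exact: Cbox].
apply: boxH; move: A mA; apply: smallest_sub.
  exact: smallest_sigma_algebra.
rewrite -bigcup_seq; apply: bigcup_sub => i _ _ [B mB <-].
apply: sub_sigma_algebra; exists (fun j => if j == i then B else setT).
  by move=> j; case: ifP.
rewrite setTI; apply/seteqP; split=> t /=.
  by move=> /(_ i); rewrite eqxx.
by move=> Bt j; case: eqP => // ->.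
Qed.

End boxes.

Section mpower_probability.
Context d (V : measurableType d) (R : realType).
Local Open Scope ereal_scope.

Lemma mpower_setT (nu : probability V R) m : mpower nu m setT = 1.
Proof.
rewrite (_ : setT = box (fun=> setT)); last exact/seteqP.
rewrite mpower_box// big1// => i _; exact: probability_setT.
Qed.

Lemma mpower_fin_num (nu : probability V R) m (A : set (m.-tuple V)) :
  measurable A -> mpower nu m A \is a fin_num.
Proof.
move=> mA; rewrite ge0_fin_numE//; apply: (@le_lt_trans _ _ 1); last exact: ltry.
by rewrite -(mpower_setT nu m); apply: le_measure; rewrite ?inE.
Qed.

Context d' (Omega : measurableType d') (mu : Omega -> probability V R) (m : nat).
Hypothesis mmu : forall A, measurable A -> measurable_fun setT (fun w => mu w A).

Lemma measurable_mpower (A : set (m.-tuple V)) : measurable A ->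
  measurable_fun setT (fun w => mpower (mu w) m A).
Proof.
move: A; apply: box_ind => [A mA|A B mA mB BA CA CB|F mF ndF CF].
- rewrite (_ : (fun w => _) = fun w => (\prod_(i < m) fine (mu w (A i)))%:E).
    apply/measurable_EFinP; apply: measurable_prod => i _.
    exact: (measurableT_comp (fine_measurable measurableT) (mmu (mA i))).
  apply/funext => w; rewrite mpower_box// -prodEFin; apply: eq_bigr => i _.
  by rewrite fineK//; exact: fin_num_measure.
- rewrite (_ : (fun w => _) =
      (fun w => mpower (mu w) m A - mpower (mu w) m B)).
    exact: emeasurable_funB.
  apply/funext => w; rewrite measureD//; last by rewrite -ge0_fin_numE// mpower_fin_num.
  by rewrite setIidr.
- apply: (emeasurable_fun_cvg (fun n w => mpower (mu w) m (F n))) => // w _.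
  apply: nondecreasing_cvg_mu => //; exact: bigcupT_measurable.
Qed.

Lemma measurable_mpower_integral (g : m.-tuple V -> \bar R) :
  (forall x, 0 <= g x) -> measurable_fun setT g ->
  measurable_fun setT (fun w => \int[mpower (mu w) m]_x g x).
Proof.
move=> g0 mg; apply: measurable_fun_integral_kernel => // A mA.
exact: measurable_mpower.
Qed.

End mpower_probability.

Lemma measurable_random_integral d d' (V : measurableType d)
    (Omega : measurableType d') (R : realType) (mu : Omega -> probability V R)
    (m : nat) (h : m.-tuple V -> R) :
  (forall A, measurable A -> measurable_fun setT (fun w => mu w A)) ->
  measurable_fun setT h -> measurable_fun setT (random_integral mu h).
Proof.
move=> mmu mh; have mhE : measurable_fun setT (EFin \o h) by exact/measurable_EFinP.
rewrite (_ : random_integral mu h = fine \o (fun w =>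
    \int[mpower (mu w) m]_x (EFin \o h)^\+ x -
    \int[mpower (mu w) m]_x (EFin \o h)^\- x)%E); last first.
  by apply/funext => w; rewrite /random_integral /Rintegral integralE.
apply: measurableT_comp; first exact: fine_measurable.
apply: emeasurable_funB; apply: measurable_mpower_integral => //.
  exact: measurable_funepos.
exact: measurable_funeneg.
Qed.

(** * Kernels that are indicators of boxes *)

Section ustat_convergence.
Context d (Omega : measurableType d) (R : realType) (P : probability Omega R).
Variables T Tinv : Omega -> Omega.
Hypothesis mT : measurable_fun setT T.
Hypothesis PT : forall A, measurable A -> P (T @^-1` A) = P A.
Context dV (V : measurableType dV) (X0 : Omega -> V).
Hypothesis mX0 : measurable_fun setT X0.
Variable mu : Omega -> probability V R.
Hypothesis hmu : regular_cond_distribution P (invariant_sets T) X0 mu.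
Variables (m : nat) (p : R).
Hypothesis p1 : 1 <= p.
Implicit Types (h g : m.-tuple V -> R).

Local Notation X := (shift_process T Tinv X0).
Let p0 : 0 < p. Proof. exact: lt_le_trans p1. Qed.

Lemma measurable_shift (k : nat) : measurable_fun setT (X k).
Proof. exact: (measurableT_comp mX0 (measurable_iter mT k)). Qed.

Lemma measurable_sample (i : m.-tuple nat) : measurable_fun setT (sample X i).
Proof.
apply/measurable_fun_tnthP => j.
rewrite (_ : _ \o _ = X (tnth i j)); first exact: measurable_shift.
by apply/funext => w /=; rewrite tnth_map.
Qed.

Lemma measurable_Ustat h n : measurable_fun setT h ->
  measurable_fun setT (Ustat h X n).
Proof.
move=> mh; apply: measurable_funM => //.
under eq_fun do rewrite big_mkcond.
apply: measurable_sum => i; case: (increasing_index _) => //.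
exact: (measurableT_comp mh (measurable_sample _)).
Qed.

Lemma cond_distribution_measurable A : measurable A ->
  measurable_fun setT (fun w => mu w A).
Proof.
move=> mA; have [GZ _ _] := hmu mA.
rewrite (_ : (fun w => _) = EFin \o (fun w => fine (mu w A))); last first.
  by apply/funext => w /=; rewrite fineK//; exact: fin_num_measure.
by apply/measurable_EFinP => _ B mB; rewrite setTI; case: (GZ _ mB).
Qed.
Let mmu := cond_distribution_measurable.

(** Invariance holds at every point, because the level sets of w |-> mu w A
    belong to the sigma-algebra of strictly invariant sets. *)
Lemma cond_distribution_invariant A w k : measurable A ->
  fine (mu (iter k T w) A) = fine (mu w A).
Proof.
move=> mA; elim: k => //= k <-; have [GZ _ _] := hmu mA.
pose c := fine (mu (iter k T w) A).
pose E := (fun w' => fine (mu w' A)) @^-1` [set c].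
have [_ TE] : invariant_sets T E by exact: GZ (measurable_set1 c).
by have : E (iter k T w) by []; rewrite -TE.
Qed.

Lemma indic_norm_le1 (S : Type) (A : set S) x : `|\1_A x : R| <= 1.
Proof. by rewrite indicE; case: (_ \in _); rewrite ?normr1 ?normr0. Qed.

(** Birkhoff's theorem for the observable 1_B(X_1) - mu_w(B), whose integral
    over an invariant set vanishes by the definition of a conditional
    expectation.  Starting at X_1 matches U-statistics, whose indices start
    at 1. *)
Lemma empirical_measure_cvg B : measurable B ->
  {ae P, forall w, negligible_power
    (fun n => \sum_(k < n) (\1_B (X k.+1 w) - fine (mu w B))) 1}.
Proof.
move=> mB; pose f w := \1_B (X0 (T w)) - fine (mu w B).
have [GZ iZ IZ] := hmu mB.
have mZ : measurable_fun setT (fun w => fine (mu w B)).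
  exact: (measurableT_comp (fine_measurable measurableT) (mmu mB)).
have mXB : measurable_fun setT (\1_(X0 @^-1` B) : _ -> R).
  apply: measurable_indic; rewrite -[X in measurable X]setTI; exact: mX0.
have muB1 w : `|fine (mu w B)| <= 1.
  rewrite ger0_norm ?fine_ge0// -lee_fin fineK ?probability_le1//.
  exact: fin_num_measure.
have mfT : measurable_fun setT (fun w => \1_B (X0 (T w)) : R).
  exact: (measurableT_comp mXB mT).
have bf : bounded_mfun f.
  split; first exact: measurable_funB.
  by exists 2 => w; rewrite (le_trans (ler_normB _ _))// (_ : 2 = 1 + 1)// lerD// indic_norm_le1.
have bind E (u : Omega -> R) : measurable E -> measurable_fun setT u ->
    (forall w, `|u w| <= 1) -> bounded_mfun (fun w => u w * \1_E w).
  move=> mE mu' u1; split.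
    by apply: measurable_funM => //; exact: measurable_indic.
  by exists 1 => w; rewrite normrM mulr_ile1// indic_norm_le1.
have f0 E : invariant_sets T E -> \int[P]_w (f w * \1_E w) = 0.
  move=> iE; have [mE TE] := iE.
  under eq_Rintegral do rewrite mulrBl.
  rewrite RintegralB//; last 2 first.
  - apply: bounded_mfun_integrable; apply: bind => // w; exact: indic_norm_le1.
  - by apply: bounded_mfun_integrable; exact: bind.
  have -> : \int[P]_w (\1_B (X0 (T w)) * \1_E w) =
      \int[P]_w (\1_(X0 @^-1` B) w * \1_E w).
    rewrite -[RHS](Rintegral_preserved mT PT); last first.
      by apply: bind => // w; exact: indic_norm_le1.
    apply: eq_Rintegral => w _; congr *%R.
    by rewrite -{1}TE.
  apply/eqP; rewrite subr_eq0; apply/eqP.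
  have EE (u : Omega -> R) : \int[P]_w (u w * \1_E w) = \int[P]_(w in E) u w.
    rewrite [RHS]Rintegral_mkcond; apply: eq_Rintegral => w _.
    by rewrite patchE indicE; case: (_ \in _); rewrite ?mulr1 ?mulr0.
  by rewrite !EE /Rintegral IZ.
apply: filterS (birkhoff mT PT bf f0) => w H e e0.
have [K HK] := H _ e0; exists K => n; move: (HK n); rewrite /birkhoff_sum /f.
by under eq_bigr do rewrite cond_distribution_invariant//.
Qed.

Lemma indic_box (A : 'I_m -> set V) t :
  \1_(box A) t = \prod_(j < m) \1_(A j) (tnth t j) :> R.
Proof.
have [At|nAt] := pselect (box A t).
  rewrite indicE mem_set// big1// => j _; rewrite indicE mem_set//; exact: At.
have /existsNP[j nAj] := nAt.
rewrite indicE memNset// (bigD1 j)//= indicE memNset// mul0r//.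
Qed.

(** The factors are extended by 1 beyond the m-th one, because the recursion on
    increasing sums indexes them by all natural numbers. *)
Lemma Ustat_box (A : 'I_m -> set V) n w : Ustat \1_(box A) X n w =
  'C(n, m)%:R^-1 *
  increasing_sum (fun j k => \1_(oapp A setT (insub j)) (X k w)) n m :> R.
Proof.
rewrite /Ustat /increasing_sum -sum_increasing_index; congr *%R.
apply: eq_bigr => i _; rewrite indic_box; apply: eq_bigr => j _.
by rewrite valK /= tnth_map (tnth_nth 0%N).
Qed.

Lemma random_integral_box (A : 'I_m -> set V) w :
  (forall i, measurable (A i)) ->
  random_integral mu \1_(box A) w =
  \prod_(j < m) fine (mu w (oapp A setT (insub (val j)))).
Proof.
move=> mA; rewrite /random_integral /Rintegral integral_indic//; last first.
  exact: measurable_box.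
rewrite setIT /= mpower_box//; apply: EFin_inj.
rewrite fineK; last first.
  by rewrite -mpower_box//; exact: mpower_fin_num (measurable_box mA).
rewrite -prodEFin; apply: eq_bigr => i _; rewrite valK /= fineK//.
exact: fin_num_measure.
Qed.

Lemma Ustat_box_cvg (A : 'I_m -> set V) : (forall i, measurable (A i)) ->
  {ae P, forall w, (fun n => Ustat \1_(box A) X n w : R) @ \oo -->
    random_integral mu \1_(box A) w}.
Proof.
move=> mA; have mA' j : measurable (oapp A setT (insub j)).
  by case: insubP => [i _ _|_] /=.
have := ae_foralln (fun j => empirical_measure_cvg (mA' j)).
apply: filterS => w H; rewrite random_integral_box//.
under eq_fun do rewrite Ustat_box.
apply: (@cvg_increasing_sum _ _
  (fun j => fine (mu w (oapp A setT (insub j))))) => // [j k|j].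
  exact: indic_norm_le1.
rewrite ger0_norm ?fine_ge0// -lee_fin fineK ?probability_le1//.
exact: fin_num_measure.
Qed.

Lemma card_increasing_index n :
  \sum_(i : m.-tuple 'I_n.+1 | increasing_index (map val i)) 1 =
  'C(n, m)%:R :> R.
Proof.
rewrite (sum_increasing_index _ _ (fun=> 1 : R)) -size_incseqs.
by rewrite big_const_seq count_predT iter_addr_0.
Qed.

Lemma Ustat_unit_interval h n w : (forall x, 0 <= h x <= 1) ->
  0 <= Ustat h X n w <= 1.
Proof.
move=> h01; have [nm|mn] := ltnP n m.
  by rewrite /Ustat bin_small// invr0 mul0r lexx ler01.
have C0 : (0 : R) < 'C(n, m)%:R by rewrite ltr0n bin_gt0.
rewrite /Ustat mulr_ge0 ?invr_ge0 ?ler0n ?sumr_ge0//=; last first.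
  by move=> i _; case/andP: (h01 (sample X (map_tuple val i) w)).
rewrite ler_pdivrMl// mulr1 -card_increasing_index.
by apply: ler_sum => i _; case/andP: (h01 (sample X (map_tuple val i) w)).
Qed.

Local Open Scope ereal_scope.

(** The p-th power of the norm in the theorem: working with it avoids the
    triangle inequality for norms and keeps all estimates pointwise. *)
Definition Udist h n : \bar R :=
  \int[P]_w (`|Ustat h X n w - random_integral mu h w| `^ p)%:E.

Definition limit_moment h : \bar R :=
  \int[P]_w \int[mpower (mu w) m]_x (`|h x| `^ p)%:E.

Definition sample_moment h (i : m.-tuple nat) : \bar R :=
  \int[P]_w (`|h (sample X i w)| `^ p)%:E.

(** The class of kernels for which the theorem holds, with the integrability
    that makes the limit meaningful. *)
Definition Uconverges h : Prop :=
  [/\ measurable_fun setT h, limit_moment h < +oo & Udist h @ \oo --> 0].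

Lemma measurable_powR_norm d' (S : measurableType d') (u : S -> R) :
  measurable_fun setT u -> measurable_fun setT (fun x => (`|u x| `^ p)%:E).
Proof.
move=> mu'; apply/measurable_EFinP; apply: (measurableT_comp (measurable_powR p)).
exact: measurableT_comp.
Qed.

Lemma measurable_Udist h n : measurable_fun setT h -> measurable_fun setT
  (fun w => (`|Ustat h X n w - random_integral mu h w| `^ p)%:E).
Proof.
move=> mh; apply: measurable_powR_norm; apply: measurable_funB.
  exact: measurable_Ustat.
exact: measurable_random_integral.
Qed.

Lemma Udist_ge0 h n : 0 <= Udist h n.
Proof. by apply: integral_ge0 => w _; rewrite lee_fin powR_ge0. Qed.

Lemma measurable_inner h : measurable_fun setT h -> measurable_fun setT
  (fun w => \int[mpower (mu w) m]_x (`|h x| `^ p)%:E).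
Proof.
move=> mh; apply: measurable_mpower_integral => //.
exact: measurable_powR_norm.
Qed.

Lemma inner_ge0 h w : 0 <= \int[mpower (mu w) m]_x (`|h x| `^ p)%:E.
Proof. by apply: integral_ge0 => x _; rewrite lee_fin powR_ge0. Qed.

Lemma ae_inner_finite h : measurable_fun setT h -> limit_moment h < +oo ->
  {ae P, forall w, \int[mpower (mu w) m]_x (`|h x| `^ p)%:E < +oo}.
Proof.
move=> mh hoo.
have : P.-integrable setT (fun w => \int[mpower (mu w) m]_x (`|h x| `^ p)%:E).
  apply/integrableP; split; first exact: measurable_inner.
  by under eq_integral do rewrite gee0_abs ?inner_ge0//.
move=> /(integrable_ae measurableT); apply: filterS => w /(_ I).
by rewrite ge0_fin_numE// inner_ge0.
Qed.

(** Jensen's inequality for the average over the increasing tuples; a bound that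
    is uniform over the samples survives the average. *)
Lemma Ustat_moment_le g (e : R) (n : nat) : (0 <= e)%R -> measurable_fun setT g ->
  (forall i : m.-tuple nat, increasing_index i -> sample_moment g i <= e%:E) ->
  \int[P]_w (`|Ustat g X n w| `^ p)%:E <= e%:E.
Proof.
move=> e0 mg ge; have [nm|mn] := ltnP n m.
  rewrite integral0_eq// => w _.
  by rewrite /Ustat bin_small// invr0 mul0r normr0 powR0// gt_eqF.
have C0 : (0 < 'C(n, m)%:R :> R)%R by rewrite ltr0n bin_gt0.
pose t (i : m.-tuple 'I_n.+1) : m.-tuple nat := map_tuple val i.
apply: (@le_trans _ _ (\int[P]_w ('C(n, m)%:R^-1%:E * \sum_(i : m.-tuple 'I_n.+1 |
    increasing_index (map val i)) (`|g (sample X (t i) w)| `^ p)%:E))).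
  apply: ge0_le_integral => //.
  - by apply: measurable_powR_norm; exact: measurable_Ustat.
  - apply: emeasurable_funM => //; under eq_fun do rewrite big_mkcond.
    apply: emeasurable_sum => i; case: (increasing_index _) => //.
    apply: measurable_powR_norm; exact: (measurableT_comp mg (measurable_sample _)).
  - move=> w _; rewrite sumEFin -EFinM lee_fin.
    by rewrite powR_mean// card_increasing_index.
have mgi i : measurable_fun setT (fun w => (`|g (sample X (t i) w)| `^ p)%:E).
  apply: measurable_powR_norm; exact: (measurableT_comp mg (measurable_sample _)).
rewrite ge0_integralZl//; last 2 first.
- under eq_fun do rewrite big_mkcond.
  by apply: emeasurable_sum => i; case: (increasing_index _).
- by move=> w _; rewrite sume_ge0// => i _; rewrite lee_fin powR_ge0.
under eq_integral do rewrite big_mkcond.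
rewrite ge0_integral_sum//; last 2 first.
- by move=> i; case: (increasing_index _).
- by move=> i w _; case: ifP => // _; rewrite lee_fin powR_ge0.
apply: (@le_trans _ _ ('C(n, m)%:R^-1%:E * \sum_(i : m.-tuple 'I_n.+1 |
    increasing_index (map val i)) e%:E)).
  rewrite lee_pmul2l// ?lte_fin ?invr_gt0// [leRHS]big_mkcond.
  apply: lee_sum => i _; case: ifP => ti; last by rewrite integral0.
  exact: ge.
rewrite sumEFin -EFinM lee_fin -[X in (_ * X)%R](_ : (e * 'C(n, m)%:R = _)%R).
  by rewrite mulrCA mulVf ?mulr1// gt_eqF.
by rewrite -card_increasing_index mulr_sumr; apply: eq_bigr => i _; rewrite mulr1.
Qed.


(** * Linear combinations and approximation of kernels *)

Lemma Ustat_linear (a : R) h g n w :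
  Ustat (fun x => a * h x + g x)%R X n w =
  (a * Ustat h X n w + Ustat g X n w)%R.
Proof.
rewrite /Ustat mulrCA -mulrDr; congr *%R.
by rewrite mulr_sumr -big_split.
Qed.

Lemma random_integral_linear (a : R) h g w :
  (mpower (mu w) m).-integrable setT (EFin \o h) ->
  (mpower (mu w) m).-integrable setT (EFin \o g) ->
  random_integral mu (fun x => a * h x + g x)%R w =
  (a * random_integral mu h w + random_integral mu g w)%R.
Proof.
move=> ih ig; rewrite /random_integral RintegralD ?RintegralZl//.
exact: (integrableZl measurableT a ih).
Qed.

Lemma ae_integrable h : measurable_fun setT h -> limit_moment h < +oo ->
  {ae P, forall w, (mpower (mu w) m).-integrable setT (EFin \o h)}.
Proof.
move=> mh hoo; apply: filterS (ae_inner_finite mh hoo) => w.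
apply: (powR_integrable p1) => //; exact: mpower_setT.
Qed.

Lemma random_integral_powR_le h w : measurable_fun setT h ->
  \int[mpower (mu w) m]_x (`|h x| `^ p)%:E < +oo ->
  (`|random_integral mu h w| `^ p)%:E <=
    \int[mpower (mu w) m]_x (`|h x| `^ p)%:E.
Proof.
by move=> mh hoo; apply: (powR_Rintegral p1) => //; exact: mpower_setT.
Qed.

Let pow3 : R := (3 `^ p)%R.
Let pow3_gt0 : (0 < pow3)%R. Proof. exact: powR_gt0. Qed.

Lemma powR_linear_le (a x y : R) : (`|a * x + y| `^ p <=
  pow3 * `|a| `^ p * `|x| `^ p + pow3 * `|y| `^ p)%R.
Proof.
rewrite -mulrA -mulrDr -powRM// -normrM -[leRHS]addr0.
have := @powR_le_sum3 _ _ p1 `|a * x + y|%R `|a * x|%R `|y|%R 0%R.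
rewrite powR0 ?gt_eqF// !addr0; apply=> //.
exact: ler_normD.
Qed.

Lemma limit_moment_linear (a : R) h g :
  measurable_fun setT h -> measurable_fun setT g ->
  limit_moment h < +oo -> limit_moment g < +oo ->
  limit_moment (fun x => a * h x + g x)%R < +oo.
Proof.
move=> mh mg hoo goo.
have c0 : (0 <= pow3 * `|a| `^ p)%R by rewrite mulr_ge0 ?powR_ge0.
have mhg : measurable_fun setT (fun x => a * h x + g x)%R.
  by apply: measurable_funD => //; exact: measurable_funM.
apply: (@le_lt_trans _ _ ((pow3 * `|a| `^ p)%:E * limit_moment h +
    pow3%:E * limit_moment g + 0%:E * \int[P]_w cst 0 w)).
  apply: ae_le_integral3 => //.
  - exact: ltW.
  - exact: measurable_inner.
  - exact: measurable_inner.
  - exact: measurable_inner.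
  - by move=> w; exact: inner_ge0.
  - by move=> w; exact: inner_ge0.
  - by move=> w; exact: inner_ge0.
  apply: aeW => w; rewrite -[0 in leRHS](integral0 (mpower (mu w) m) setT).
  apply: ae_le_integral3 => //.
  - exact: ltW.
  - exact: measurable_powR_norm.
  - exact: measurable_powR_norm.
  - exact: measurable_powR_norm.
  by apply: aeW => x; rewrite mule0 adde0 -!EFinM -EFinD lee_fin powR_linear_le.
rewrite [X in _ + X < _]mul0e adde0.
apply: lte_add_pinfty; apply: lte_mul_pinfty.
- rewrite lee_fin; exact: c0.
- by [].
- exact: hoo.
- rewrite lee_fin; exact: ltW pow3_gt0.
- by [].
- exact: goo.
Qed.

Lemma Uconverges_linear (a : R) h g : Uconverges h -> Uconverges g ->
  Uconverges (fun x => a * h x + g x)%R.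
Proof.
move=> [mh hoo ch] [mg goo cg].
have mhg : measurable_fun setT (fun x => a * h x + g x)%R.
  by apply: measurable_funD => //; exact: measurable_funM.
split; [exact: mhg|exact: limit_moment_linear|].
have c0 : (0 <= pow3 * `|a| `^ p)%R by rewrite mulr_ge0 ?powR_ge0.
apply: (@squeeze_cvge _ _ _ _ (cst 0) _ (fun n =>
    (pow3 * `|a| `^ p)%:E * Udist h n + pow3%:E * Udist g n)).
- apply: nearW => n; rewrite Udist_ge0 /=.
  rewrite -[leRHS]adde0 -(mule0 0%:E) -[X in 0%:E * X](integral0 P setT).
  apply: ae_le_integral3 => //.
  + exact: ltW.
  + exact: measurable_Udist.
  + exact: measurable_Udist.
  + exact: measurable_Udist.
  apply: filterS2 (ae_integrable mh hoo) (ae_integrable mg goo) => w ih ig.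
  rewrite mule0 adde0 Ustat_linear random_integral_linear//.
  rewrite -!EFinM -EFinD lee_fin; apply: le_trans (powR_linear_le _ _ _).
  by rewrite le_eqVlt; apply/orP; left; apply/eqP; congr (`|_| `^ p)%R; ring.
- exact: cvg_cst.
- have c1 := cvgeZl (isT : (pow3 * `|a| `^ p)%:E \is a fin_num) ch.
  have c2 := cvgeZl (isT : pow3%:E \is a fin_num) cg.
  rewrite (mule0 (pow3 * `|a| `^ p)%:E) in c1; rewrite (mule0 pow3%:E) in c2.
  have c3 := cvgeD (isT : (0 : \bar R) +? 0) c1 c2.
  rewrite (adde0 0) in c3; exact: c3.
Qed.

(** U(h) - I(h) = U(h - g) + (U(g) - I(g)) - I(h - g); Jensen's inequality
    bounds the last term by a moment of h - g, for almost every w. *)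
Lemma Udist_triangle h g n :
  measurable_fun setT h -> measurable_fun setT g ->
  limit_moment (h \- g)%R < +oo -> limit_moment g < +oo ->
  Udist h n <= pow3%:E * \int[P]_w (`|Ustat (h \- g)%R X n w| `^ p)%:E +
    pow3%:E * Udist g n + pow3%:E * limit_moment (h \- g)%R.
Proof.
move=> mh mg hgoo goo.
have mhg : measurable_fun setT (h \- g)%R by exact: measurable_funB.
apply: ae_le_integral3 => //; try exact: ltW.
- exact: measurable_Udist.
- by apply: measurable_powR_norm; exact: measurable_Ustat.
- exact: measurable_Udist.
- exact: measurable_inner.
- by move=> w; exact: inner_ge0.
apply: filterS3 (ae_integrable mhg hgoo) (ae_integrable mg goo)
  (ae_inner_finite mhg hgoo) => w ihg ig hgw.
have hE : h = (fun x => 1 * (h \- g) x + g x)%R.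
  by apply/funext => x /=; rewrite mul1r subrK.
apply: (@le_trans _ _ (pow3%:E * (`|Ustat (h \- g)%R X n w| `^ p)%:E +
    pow3%:E * (`|Ustat g X n w - random_integral mu g w| `^ p)%:E +
    pow3%:E * (`|random_integral mu (h \- g)%R w| `^ p)%:E)); last first.
  by rewrite leeD2l// lee_pmul2l// random_integral_powR_le.
rewrite -!EFinM -!EFinD lee_fin -!mulrDr; apply: powR_le_sum3 => //.
rewrite {1 2}hE Ustat_linear random_integral_linear// !mul1r.
set u := Ustat (h \- g)%R X n w; set v := random_integral mu (h \- g)%R w.
set u' := Ustat g X n w; set v' := random_integral mu g w.
rewrite (_ : u + u' - (v + v') = u + (u' - v') - v)%R; last by ring.
by rewrite (le_trans (ler_normB _ _))// lerD2r ler_normD.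
Qed.


Lemma Uconverges_approx h : measurable_fun setT h ->
  (forall e : R, (0 < e)%R -> exists g, [/\ Uconverges g,
     forall i : m.-tuple nat, increasing_index i ->
       sample_moment (h \- g)%R i <= e%:E &
     limit_moment (h \- g)%R <= e%:E]) ->
  Uconverges h.
Proof.
move=> mh H; split=> //.
  have [g [[mg goo _] _ hg]] := H 1%R ltr01.
  rewrite (_ : h = (fun x => 1 * (h \- g) x + g x)%R); last first.
    by apply/funext => x /=; rewrite mul1r subrK.
  apply: limit_moment_linear.
  - exact: measurable_funB.
  - exact: mg.
  - exact: le_lt_trans hg (ltry _).
  - exact: goo.
apply/cvge_0P; first exact: Udist_ge0.
move=> e e0; pose del := (e / (3 * pow3))%R.
have del0 : (0 < del)%R by rewrite divr_gt0// mulr_gt0.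
have [g [[mg goo cg] Sg Lg]] := H _ del0.
have mhg : measurable_fun setT (h \- g)%R by exact: measurable_funB.
have hgoo : limit_moment (h \- g)%R < +oo by exact: le_lt_trans Lg (ltry _).
move/(cvge_0P _ (Udist_ge0 g)) : cg => /(_ _ del0).
apply: filterS => n Un; apply: le_trans (Udist_triangle n mh mg hgoo goo) _.
have -> : e%:E = pow3%:E * del%:E + pow3%:E * del%:E + pow3%:E * del%:E.
  by rewrite -!EFinM -!EFinD; congr EFin; rewrite /del; field; rewrite gt_eqF.
have leZ (x y : \bar R) : x <= y -> pow3%:E * x <= pow3%:E * y.
  by move=> xy; rewrite lee_wpmul2l// lee_fin ltW.
apply: leeD; last exact: leZ.
apply: leeD; apply: leZ; last exact: Un.
by apply: Ustat_moment_le; [exact: ltW|exact: mhg|exact: Sg].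
Qed.

Lemma powR_indic (S : Type) (A : set S) x : (`|\1_A x : R| `^ p = \1_A x)%R.
Proof.
by rewrite indicE; case: (_ \in _); rewrite ?normr1 ?normr0 ?powR1 ?powR0// gt_eqF.
Qed.

Lemma limit_moment_indic A : measurable A ->
  limit_moment \1_A = \int[P]_w mpower (mu w) m A.
Proof.
move=> mA; apply: eq_integral => w _.
by under eq_integral do rewrite powR_indic; rewrite integral_indic// setIT.
Qed.

Lemma limit_moment_indic_fin A : measurable A -> limit_moment \1_A < +oo.
Proof.
move=> mA; rewrite limit_moment_indic//.
apply: (@le_lt_trans _ _ (\int[P]_w cst 1 w)).
  apply: ge0_le_integral => //; first exact: measurable_mpower.
  move=> w _; rewrite -(mpower_setT (mu w) m); apply: le_measure; rewrite ?inE//.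
by rewrite integral_cst// mul1e (le_lt_trans (probability_le1 P _))// ltry.
Qed.

Lemma sample_moment_indic A i : measurable A ->
  sample_moment \1_A i = P (sample X i @^-1` A).
Proof.
move=> mA; rewrite /sample_moment; under eq_integral do rewrite powR_indic.
rewrite (_ : (fun w => _) = fun w => (\1_(sample X i @^-1` A) w)%:E)//.
rewrite integral_indic ?setIT// -[X in measurable X]setTI.
exact: measurable_sample.
Qed.

Lemma Uconverges_box (A : 'I_m -> set V) : (forall i, measurable (A i)) ->
  Uconverges \1_(box A).
Proof.
move=> mA; have mB := measurable_box mA.
have mI : measurable_fun setT (\1_(box A) : m.-tuple V -> R).
  exact: measurable_indic.
split=> //; first exact: limit_moment_indic_fin.
have unit_itv x : (0 <= (\1_(box A) x : R) <= 1)%R.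
  by rewrite indicE; case: (_ \in _); rewrite /= ?ler01 ?lexx.
have RI01 w : (0 <= random_integral mu \1_(box A) w <= 1)%R.
  rewrite random_integral_box// prodr_ge0 => [|i _]; last exact: fine_ge0.
  rewrite prodr_ile1// => i _; rewrite fine_ge0//= -lee_fin.
  have mAi : measurable (oapp A setT (insub (val i))) by rewrite valK; exact: mA.
  by rewrite fineK; [exact: probability_le1|exact: fin_num_measure].
have [] := @dominated_convergence _ _ _ P setT measurableT
  (fun n w => (`|Ustat \1_(box A) X n w - random_integral mu \1_(box A) w| `^ p)%:E)
  (cst 0) (cst 1).
- by move=> n; exact: measurable_Udist.
- exact: measurable_cst.
- apply: filterS (Ustat_box_cvg mA) => w Uw _.
  apply/fine_cvgP; split; first exact: nearW.
  apply/cvgrPdist_le => e e0 /=.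
  have e0' : (0 < e `^ p^-1)%R by rewrite powR_gt0.
  move/cvgrPdist_le : Uw => /(_ _ e0'); apply: filterS => n Un.
  rewrite sub0r normrN ger0_norm ?powR_ge0// distrC.
  rewrite (@le_trans _ _ ((e `^ p^-1) `^ p)%R)//.
    by rewrite ge0_ler_powR ?nnegrE ?powR_ge0 ?(ltW p0).
  by rewrite -powRrM mulVf ?gt_eqF// powRr1// ltW.
- by apply: finite_measure_integrable_cst.
- apply: aeW => w n _; rewrite gee0_abs ?lee_fin ?powR_ge0//= ?lee_fin.
  rewrite [leRHS](_ : 1 = 1 `^ p)%R; last by rewrite powR1.
  rewrite ge0_ler_powR ?nnegrE ?(ltW p0)// ler_norml.
  have /andP[U0 U1] := Ustat_unit_interval n w unit_itv.
  have /andP[I0 I1] := RI01 w; apply/andP; split; lra.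
by move=> _ _; rewrite integral0; apply.
Qed.

(** * From boxes to uniformly integrable kernels *)

(** The laws of all the samples are equicontinuous from above at the empty set:
    this is what allows a monotone limit of sets to be taken uniformly over the
    samples. *)
Definition uniformly_vanishing := forall B : nat -> set (m.-tuple V),
  (forall k, measurable (B k)) -> nonincreasing_seq B ->
  \bigcap_k B k = set0 -> forall e : R, (0 < e)%R ->
  \forall k \near \oo, forall i : m.-tuple nat, increasing_index i ->
    P (sample X i @^-1` B k) <= e%:E.

(** The analogous property of the limit law comes for free, as it is a single
    probability measure. *)
Lemma limit_moment_vanishing (B : nat -> set (m.-tuple V)) :
  (forall k, measurable (B k)) -> nonincreasing_seq B ->
  \bigcap_k B k = set0 -> (fun k => limit_moment \1_(B k)) @ \oo --> 0.
Proof.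
move=> mB niB B0.
under eq_fun do rewrite limit_moment_indic//.
have [] := @dominated_convergence _ _ _ P setT measurableT
  (fun k w => mpower (mu w) m (B k)) (cst 0) (cst 1).
- by move=> k; exact: measurable_mpower.
- exact: measurable_cst.
- apply: aeW => w _; rewrite -(measure0 (mpower (mu w) m)) -B0.
  apply: nonincreasing_cvg_mu => //; last exact: bigcapT_measurable.
  by rewrite -ge0_fin_numE// mpower_fin_num.
- by apply: finite_measure_integrable_cst.
- apply: aeW => w k _; rewrite gee0_abs// -(mpower_setT (mu w) m).
  by apply: le_measure; rewrite ?inE.
by move=> _ _; rewrite integral0; apply.
Qed.

Hypothesis vanishing : uniformly_vanishing.

Lemma Uconverges_indic A : measurable A -> Uconverges \1_A.
Proof.
have indicB (C D : set (m.-tuple V)) : D `<=` C ->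
    (\1_C \- \1_D)%R = \1_(C `\` D) :> (_ -> R).
  move=> DC; apply/funext => x; rewrite /= !indicE in_setD.
  have [xD|xD] := boolP (x \in D); last by rewrite subr0 andbT.
  by rewrite (mem_set (DC _ (set_mem xD))) subrr.
move: A; apply: box_ind => [A mA|A B mA mB BA CA CB|F mF ndF CF].
- exact: Uconverges_box.
- rewrite -(indicB _ _ BA) (_ : (_ \- _)%R = (fun x => -1 * \1_B x + \1_A x)%R).
    exact: Uconverges_linear.
  by apply/funext => x /=; rewrite mulN1r addrC.
- have mU : measurable (\bigcup_n F n) by exact: bigcupT_measurable.
  apply: Uconverges_approx; first exact: measurable_indic.
  move=> e e0; pose B k := \bigcup_n F n `\` F k.
  have mB k : measurable (B k) by exact: measurableD.
  have niB : nonincreasing_seq B.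
    by move=> k l kl; apply/subsetPset; apply: setDS; exact/subsetPset/ndF.
  have B0 : \bigcap_k B k = set0.
    apply/seteqP; split=> // x Bx; have [[n _ Fx] _] := Bx 0%N I.
    by have [_] := Bx n I; exact.
  have lm0 k : 0 <= limit_moment \1_(B k).
    by apply: integral_ge0 => w _; exact: inner_ge0.
  have /(cvge_0P _ lm0)/(_ _ e0) Lk := limit_moment_vanishing mB niB B0.
  have [k [Sk {}Lk]] := filter_ex (filterI (vanishing mB niB B0 e0) Lk).
  exists \1_(F k); rewrite indicB; last by move=> x Fx; exists k.
  split; [exact: CF|move=> i ii|exact: Lk].
  by rewrite (sample_moment_indic i (mB k)); exact: Sk.
Qed.

Lemma Uconverges_cst (c : R) : Uconverges (fun=> c).
Proof.
have C1 : Uconverges \1_setT by exact: Uconverges_indic.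
rewrite (_ : (fun=> c) = (fun x => (c - 1) * \1_setT x + \1_setT x)%R).
  exact: Uconverges_linear.
by apply/funext => x; rewrite indicT /=; ring.
Qed.

Lemma moments_bounded h (e : R) : measurable_fun setT h ->
  (forall x, (`|h x| `^ p <= e)%R) ->
  (forall i, sample_moment h i <= e%:E) /\ limit_moment h <= e%:E.
Proof.
move=> mh he.
have cst_int d' (S : measurableType d') (nu : {measure set S -> \bar R}) :
    nu setT = 1 -> \int[nu]_x e%:E = e%:E.
  by move=> nu1; rewrite integral_cst// nu1 mule1.
have bnd d' (S : measurableType d') (nu : {measure set S -> \bar R})
    (u : S -> m.-tuple V) : nu setT = 1 -> measurable_fun setT u ->
    \int[nu]_x (`|h (u x)| `^ p)%:E <= e%:E.
  move=> nu1 mu'; apply: (@le_trans _ _ (\int[nu]_x e%:E)).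
    apply: ge0_le_integral => //.
    - by apply: measurable_powR_norm; exact: measurableT_comp.
    - by move=> x _; rewrite lee_fin.
  by rewrite cst_int.
have P1 : P setT = 1 by exact: probability_setT.
split=> [i|]; first by apply: bnd => //; exact: measurable_sample.
apply: (@le_trans _ _ (\int[P]_x e%:E)); last by rewrite cst_int.
apply: ge0_le_integral => //; first by move=> w _; exact: inner_ge0.
  exact: measurable_inner.
by move=> w _; apply: (bnd _ _ _ id) => //; exact: mpower_setT.
Qed.

(** A bounded kernel is within r of a step function with finitely many steps of
    height r; the p-th power of r is the prescribed precision. *)
Lemma Uconverges_bounded h (M : R) : measurable_fun setT h ->
  (forall x, (`|h x| <= M)%R) -> Uconverges h.
Proof.
move=> mh hM; apply: Uconverges_approx => // e e0.
pose r := (e `^ p^-1)%R.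
have r0 : (0 < r)%R by rewrite powR_gt0.
have [N /ltW HN] : exists N : nat, (2 * M / r < N%:R)%R.
  by exists (Num.truncn (2 * M / r)).+1; exact: truncnS_gt.
rewrite ler_pdivrMr// mulrC in HN.
pose A j := [set x | (r * j.+1%:R <= h x + M)%R].
have mA j : measurable (A j).
  rewrite (_ : A j = (fun x => h x + M)%R @^-1` `[(r * j.+1%:R)%R, +oo[).
    rewrite -[X in measurable X]setTI.
    by apply: measurable_funD => //; exact: measurable_itv.
  by apply/seteqP; split=> x /=; rewrite in_itv /= andbT.
pose g x := (\sum_(j < N) r * \1_(A j) x - M)%R.
have Ug : Uconverges g.
  rewrite /g; elim: (N) => [|k IH].
    by under eq_fun do rewrite big_ord0; exact: Uconverges_cst.
  rewrite (_ : (fun x => _) =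
      (fun x => r * \1_(A k) x + (\sum_(j < k) r * \1_(A j) x - M))%R).
    by apply: Uconverges_linear; [exact: Uconverges_indic|exact: IH].
  by apply/funext => x; rewrite big_ord_recr /=; ring.
have mg : measurable_fun setT g by case: Ug.
have hg x : (`|(h \- g)%R x| `^ p <= e)%R.
  have -> : e = (r `^ p)%R by rewrite /r -powRrM mulVf ?gt_eqF// powRr1// ltW.
  rewrite ge0_ler_powR ?nnegrE ?(ltW p0) ?(ltW r0)//.
  have := hM x; rewrite ler_norml => /andP[hM1 hM2].
  have hM0 : (0 <= h x + M <= r * N%:R)%R by apply/andP; split; lra.
  have := staircase_approx (ltW r0) hM0.
  rewrite (_ : \sum_(j < N) _ = \sum_(j < N) r * \1_(A j) x)%R.
    move=> /andP[H1 H2]; rewrite ler_norml /= /g.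
    by apply/andP; split; lra.
  apply: eq_bigr => j _; rewrite indicE; congr (_ * (nat_of_bool _)%:R)%R.
  by apply/idP/idP; rewrite in_setE.
have [Sg Lg] := moments_bounded (measurable_funB mh mg) hg.
by exists g; split; [exact: Ug|move=> i _; exact: Sg|exact: Lg].
Qed.


Lemma powR_norm_mul_indic (S : Type) (u : S -> R) (A : set S) x :
  (`|u x * \1_A x| `^ p = `|u x| `^ p * \1_A x)%R.
Proof. by rewrite normrM powRM// powR_indic. Qed.

Lemma measurable_tail h (K : R) : measurable_fun setT h ->
  measurable [set x | (K < `|h x| `^ p)%R].
Proof.
move=> mh; have mhp : measurable_fun setT (fun x => `|h x| `^ p)%R.
  by apply/measurable_EFinP; exact: measurable_powR_norm.
rewrite (_ : [set x | _] = (fun x => `|h x| `^ p)%R @^-1` `]K, +oo[).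
  by rewrite -[X in measurable X]setTI; apply: mhp => //; exact: measurable_itv.
by apply/seteqP; split=> x /=; rewrite in_itv /= andbT.
Qed.

(** Dominated convergence twice: under mu_w^m for almost every w, and then
    under P. *)
Lemma limit_moment_tail h : measurable_fun setT h -> limit_moment h < +oo ->
  (fun k : nat => limit_moment
    (fun x => h x * \1_[set x | k%:R < `|h x| `^ p] x)%R) @ \oo --> 0.
Proof.
move=> mh hoo; pose A (k : nat) := [set x | (k%:R < `|h x| `^ p)%R].
have mA k : measurable (A k) by exact: measurable_tail.
have mhA k : measurable_fun setT (fun x => h x * \1_(A k) x)%R.
  by apply: measurable_funM => //; exact: measurable_indic.
have hA_le k x : (`|h x * \1_(A k) x| `^ p <= `|h x| `^ p)%R.
  by rewrite powR_norm_mul_indic ler_piMr ?powR_ge0.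
have inner_le k w : \int[mpower (mu w) m]_x (`|h x * \1_(A k) x| `^ p)%:E <=
    \int[mpower (mu w) m]_x (`|h x| `^ p)%:E.
  apply: ge0_le_integral => //.
  - exact: measurable_powR_norm.
  - exact: measurable_powR_norm.
  - by move=> x _; rewrite lee_fin.
have [] := @dominated_convergence _ _ _ P setT measurableT
  (fun k w => \int[mpower (mu w) m]_x (`|h x * \1_(A k) x| `^ p)%:E) (cst 0)
  (fun w => \int[mpower (mu w) m]_x (`|h x| `^ p)%:E).
- by move=> k; exact: measurable_inner.
- exact: measurable_cst.
- apply: filterS (ae_inner_finite mh hoo) => w hw _.
  have [] := @dominated_convergence _ _ _ (mpower (mu w) m) setT measurableT
    (fun k x => (`|h x * \1_(A k) x| `^ p)%:E) (cst 0)
    (fun x => (`|h x| `^ p)%:E).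
  + by move=> k; exact: measurable_powR_norm.
  + exact: measurable_cst.
  + apply: aeW => x _.
    have [k xk] : exists k : nat, (`|h x| `^ p < k%:R)%R.
      by exists (Num.truncn (`|h x| `^ p)).+1; exact: truncnS_gt.
    apply: cvg_near_cst; exists k => // l /= kl.
    rewrite powR_norm_mul_indic indicE memNset ?mulr0//= => /lt_trans/(_ xk).
    by rewrite ltr_nat ltnNge kl.
  + apply/integrableP; split; first exact: measurable_powR_norm.
    by under eq_integral do rewrite /= ger0_norm ?powR_ge0//.
  + apply: aeW => x k _; rewrite gee0_abs ?lee_fin ?powR_ge0//.
  by move=> _ _; rewrite integral0; apply.
- apply/integrableP; split; first exact: measurable_inner.
  by under eq_integral do rewrite gee0_abs ?inner_ge0//.
- by apply: aeW => w k _; rewrite gee0_abs ?inner_ge0.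
by move=> _ _; rewrite integral0; apply.
Qed.

(** The truncation level is placed on |h| ^ p rather than on |h|, so that the
    tails are those in the definition of uniform integrability; the truncated
    kernel is bounded because |h| <= 1 + |h| ^ p. *)
Lemma Uconverges_uniformly_integrable h :
  measurable_fun setT h -> limit_moment h < +oo ->
  uniformly_integrable P [set i : m.-tuple nat | increasing_index i]
    (fun i w => `|h (sample X i w)| `^ p)%R ->
  Uconverges h.
Proof.
move=> mh hoo UI; apply: Uconverges_approx; first exact: mh.
move=> e e0; pose A (k : nat) := [set x | (k%:R < `|h x| `^ p)%R].
have mA k : measurable (A k) by exact: measurable_tail.
have lm0 k : 0 <= limit_moment (fun x => h x * \1_(A k) x)%R.
  by apply: integral_ge0 => w _; exact: inner_ge0.
have /(cvge_0P _ lm0)/(_ _ e0) Lk := limit_moment_tail mh hoo.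
pose tail_sup K := ereal_sup [set \int[P]_(w in [set w |
    (K < `| `|h (sample X i w)| `^ p|)%R]) (`| `|h (sample X i w)| `^ p|)%:E
  | i in [set i : m.-tuple nat | increasing_index i]].
have Sk : \forall k \near \oo, forall i : m.-tuple nat, increasing_index i ->
    sample_moment (fun x => h x * \1_(A k) x)%R i <= e%:E.
  have UIn : tail_sup k%:R @[k --> \oo] --> 0 by exact: cvg_comp cvgr_idn UI.
  have {}UIn : \forall k \near \oo, tail_sup k%:R <= e%:E.
    move/fine_cvgP : UIn => [fin /cvgrPdist_le/(_ _ e0)].
    apply: filterS2 fin => k fink; rewrite sub0r normrN => ke.
    by rewrite -(fineK fink) lee_fin (le_trans (ler_norm _)).
  apply: filterS UIn => k tk i ii; apply: le_trans tk.
  apply: ereal_sup_ge; exists (sample_moment (fun x => h x * \1_(A k) x)%R i) => //.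
  exists i => //; rewrite integral_mkcond; apply: eq_integral => w _.
  rewrite powR_norm_mul_indic patchE indicE ger0_norm ?powR_ge0//.
  rewrite (_ : (w \in _) = (sample X i w \in A k)).
    by case: (_ \in _); rewrite ?mulr1 ?mulr0.
  by apply/idP/idP; rewrite !in_setE /A /= (ger0_norm (powR_ge0 _ _)).
have [k [{}Sk {}Lk]] := filter_ex (filterI Sk Lk).
pose g x := (h x * \1_(~` A k) x)%R.
have mg : measurable_fun setT g.
  by apply: measurable_funM => //; apply: measurable_indic; exact: measurableC.
have gE : (h \- g)%R = (fun x => h x * \1_(A k) x)%R.
  apply/funext => x /=; rewrite /g -[X in (X - _)%R]mulr1 -mulrBr; congr (_ * _)%R.
  by rewrite !indicE in_setC; case: (_ \in _); rewrite ?subr0 ?subrr.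
exists g; rewrite gE; split; [|exact: Sk|exact: Lk].
apply: (@Uconverges_bounded _ (1 + k%:R)%R) => // x.
rewrite /g indicE in_setC; case: (boolP (x \in A k)) => xA.
  by rewrite mulr0 normr0 addr_ge0.
rewrite mulr1 (le_trans (ler_add1_powR p1 (normr_ge0 _)))// lerD2l leNgt.
by apply: contra xA => xA; exact/mem_set.
Qed.

Lemma Uconverges_Lnorm h : Uconverges h ->
  (fun n => 'N[P]_(p%:E)[EFin \o (Ustat h X n \- random_integral mu h)%R])
    @ \oo --> 0.
Proof.
move=> [mh _ ch]; apply/cvge_0P => [n|e e0]; first exact: Lnorm_ge0.
have ep0 : (0 < e `^ p)%R by rewrite powR_gt0.
move/(cvge_0P _ (Udist_ge0 h)) : ch => /(_ _ ep0); apply: filterS => n Un.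
have -> : e%:E = (e `^ p)%:E `^ p^-1.
  by rewrite poweR_EFin -powRrM divff ?gt_eqF// powRr1// ltW.
have UE : \int[P]_w `|(EFin \o (Ustat h X n \- random_integral mu h)%R) w| `^ p =
    Udist h n by [].
rewrite unlock UE; apply: gt0_ler_poweR => //.
- by rewrite invr_ge0 ltW.
- by rewrite in_itv /= Udist_ge0 leey.
- by rewrite in_itv /= lee_fin (ltW ep0) leey.
Qed.

End ustat_convergence.


(** * Samples with densities bounded in L^q *)

Section density.
Context d (Omega : measurableType d) (R : realType) (P : probability Omega R).
Variables T Tinv : Omega -> Omega.
Hypothesis mT : measurable_fun setT T.
Hypothesis PT : forall A, measurable A -> P (T @^-1` A) = P A.
Context dV (V : measurableType dV) (X0 : Omega -> V).
Hypothesis mX0 : measurable_fun setT X0.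
Variables (lam : {sigma_finite_measure set V -> \bar R}) (m : nat).

Local Notation X := (shift_process T Tinv X0).
Let mX := measurable_shift Tinv mT mX0.
Let msample := measurable_sample Tinv mT mX0.
Local Open Scope ereal_scope.

Lemma stationary (k : nat) A : measurable A -> P (X k @^-1` A) = P (X0 @^-1` A).
Proof.
move=> mA; elim: k => [//|k <-]; rewrite -[RHS]PT.
  by congr (P _); apply/seteqP; split=> w; rewrite /shift_process /= -iterS iterSr.
by rewrite -[X in measurable X]setTI; exact: mX.
Qed.

(** Beyond the level L, y ^ (q - 1) is at least L ^ (q - 1). *)
Lemma density_interpolation (y L q : R) : (0 <= y)%R -> (0 < L)%R -> (1 < q)%R ->
  (y <= L + (L `^ (q - 1))^-1 * y `^ q)%R.
Proof.
move=> y0 L0 q1; have L1 : (0 < L `^ (q - 1))%R by rewrite powR_gt0.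
have [yL|/ltW Ly] := leP y L.
  by rewrite (le_trans yL)// lerDl mulr_ge0 ?powR_ge0// invr_ge0 ltW.
rewrite (@le_trans _ _ ((L `^ (q - 1))^-1 * y `^ q)%R)// ?lerDr ?(ltW L0)//.
rewrite ler_pdivlMl// -(mulr_powRB1 y0) ?(lt_trans ltr01)// mulrC ler_wpM2l//.
by rewrite ge0_ler_powR ?nnegrE ?subr_ge0 ?(ltW q1) ?(ltW L0).
Qed.

(** A quantitative absolute continuity that depends on the density only through
    the bound M: the choice of L large makes the second term small, and then
    a small reference measure does the same for the first. *)
Lemma density_small_sets (nu : set (m.-tuple V) -> \bar R) f (q M L : R) A :
  has_density nu (mpower lam m) f -> (1 < q)%R -> (0 < L)%R ->
  \int[mpower lam m]_t (f t `^ q)%:E <= M%:E -> measurable A ->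
  nu A <= L%:E * mpower lam m A + (M / L `^ (q - 1))%:E.
Proof.
move=> [mf f0 nuf] q1 L0 fM mA; rewrite nuf//.
have c0 : (0 <= (L `^ (q - 1))^-1)%R by rewrite invr_ge0 powR_ge0.
have mfq : measurable_fun setT (fun t => (f t `^ q)%:E).
  apply/measurable_EFinP; exact: (measurableT_comp (measurable_powR q) mf).
have mfA : measurable_fun A (EFin \o f).
  by apply/measurable_EFinP; exact: measurable_funTS.
have mfqA : measurable_fun A (fun t => (f t `^ q)%:E) by exact: measurable_funTS.
apply: (@le_trans _ _ (\int[mpower lam m]_(t in A)
    (L%:E + (L `^ (q - 1))^-1%:E * (f t `^ q)%:E))).
  apply: ge0_le_integral => //.
  - by move=> t _; rewrite lee_fin.
  - by apply: emeasurable_funD => //; exact: emeasurable_funM.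
  - by move=> t _; rewrite -EFinM -EFinD lee_fin density_interpolation.
rewrite ge0_integralD//; last 3 first.
- by move=> t _; rewrite lee_fin ltW.
- by move=> t _; rewrite -EFinM lee_fin mulr_ge0// powR_ge0.
- exact: emeasurable_funM.
rewrite integral_cst// leeD2l//.
have fq0 t : 0 <= (f t `^ q)%:E by rewrite lee_fin powR_ge0.
rewrite ge0_integralZl_EFin// mulrC EFinM; apply: lee_wpmul2l.
  by rewrite lee_fin.
by apply: le_trans fM; apply: ge0_subset_integral.
Qed.

Lemma sample_outside_box (A : set V) (i : m.-tuple nat) : measurable A ->
  P (sample X i @^-1` ~` box (fun=> A)) <= m%:R%:E * P (X0 @^-1` ~` A).
Proof.
move=> mA; have mAC := measurableC mA.
have mXC (k : nat) : measurable (X k @^-1` ~` A).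
  by rewrite -[X in measurable X]setTI; exact: mX.
apply: (@le_trans _ _ (\sum_(j < m) P (X (tnth i j) @^-1` ~` A))).
  under eq_bigr do rewrite (tnth_nth 0%N).
  apply: le_trans (Boole_inequality P (fun j _ => mXC (nth 0%N i j))).
  apply: le_measure; rewrite ?inE.
  - rewrite -[X in measurable X]setTI; apply: msample => //.
    by apply: measurableC; exact: measurable_box.
  - exact: bigsetU_measurable.
  rewrite -(bigcup_mkord m (fun j => X (nth 0%N i j) @^-1` ~` A)).
  move=> w /existsNP[j nAj]; exists j => //=.
  by move: nAj; rewrite tnth_map (tnth_nth 0%N).
under eq_bigr do rewrite (stationary _ mAC).
by rewrite sumr_const card_ord mule_natl.
Qed.

(** By stationarity, a set of finite reference measure that carries most of the
    law of X_0 yields a box of finite reference measure that carries most of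
    the law of every sample.  Inside this box, sets decreasing to the empty set
    have reference measures tending to 0. *)
Theorem density_uniformly_vanishing (f : m.-tuple nat -> m.-tuple V -> R) (q : R) :
  (forall i : m.-tuple nat, increasing_index i ->
    has_density (pushforward P (sample X i)) (mpower lam m) (f i)) ->
  (1 < q)%R ->
  ereal_sup [set \int[mpower lam m]_t (f i t `^ q)%:E
            | i in [set i : m.-tuple nat | increasing_index i]] < +oo ->
  uniformly_vanishing P T Tinv X0 m.
Proof.
move=> hf q1 fsup B mB niB B0 e e0.
have [M M0 HM] : exists2 M : R, (0 <= M)%R & forall i : m.-tuple nat,
    increasing_index i -> \int[mpower lam m]_t (f i t `^ q)%:E <= M%:E.
  move: fsup; set S := ereal_sup _ => Soo.
  have [M M0 SM] : exists2 M : R, (0 <= M)%R & S <= M%:E.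
    case: S Soo => [r _|//|_]; last by exists 0%R => //; exact: leNye.
    by exists (Num.max r 0)%R; rewrite ?lee_fin le_max lexx ?orbT.
  exists M => // i ii; apply: le_trans SM; apply: ereal_sup_ubound.
  by exists i.
have e4 : (0 < e / 4)%R by rewrite divr_gt0.
(* The level for which M / L ^ (q - 1) <= e / 4. *)
pose L := ((M / (e / 4) + 1) `^ (q - 1)^-1)%R.
have Mp : (0 < M / (e / 4) + 1)%R.
  by rewrite ltr_wpDl// divr_ge0// ltW.
have L0 : (0 < L)%R by rewrite powR_gt0.
have Lq : (L `^ (q - 1) = M / (e / 4) + 1)%R.
  rewrite /L -powRrM mulVf ?powRr1 ?ltW//.
  by rewrite gt_eqF// subr_gt0.
have ML : (M / L `^ (q - 1) <= e / 4)%R.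
  rewrite Lq ler_pdivrMr// mulrDr mulr1 mulrCA divff ?gt_eqF// mulr1.
  by rewrite lerDl ltW.
have /sigma_finiteP[F [FT ndF Foo]] := sigma_finiteT lam.
have mF k : measurable (F k) by case: (Foo k).
have mXF k : measurable (X0 @^-1` ~` F k).
  by rewrite -[X in measurable X]setTI; apply: mX0 => //; exact: measurableC.
have [N XN] : exists N, P (X0 @^-1` ~` F N) <= (e / 4 / m.+1%:R)%:E.
  have c : (fun k => P (X0 @^-1` ~` F k)) @ \oo --> 0.
    rewrite -(measure0 P).
    have -> : set0 = \bigcap_k (X0 @^-1` ~` F k).
      apply/esym/seteqP; split=> // w Fw.
      have [k _ Fk] : (\bigcup_k F k) (X0 w) by rewrite -FT.
      exact: (Fw k I Fk).
    apply: nonincreasing_cvg_mu => //.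
    - by rewrite -ge0_fin_numE// fin_num_measure.
    - exact: bigcapT_measurable.
    - move=> k l kl; apply/subsetPset; apply: preimage_subset.
      by apply: subsetC; exact/subsetPset/ndF.
  have e4m : (0 < e / 4 / m.+1%:R)%R by rewrite divr_gt0.
  have /(cvge_0P _ (fun k => measure_ge0 P _))/(_ _ e4m) := c.
  by move=> /filter_ex[N HN]; exists N.
pose D := box (fun _ : 'I_m => F N).
have mD : measurable D by exact: measurable_box.
have mBD k : measurable (B k `&` D) by exact: measurableI.
have lamBD : (fun k => mpower lam m (B k `&` D)) @ \oo --> 0.
  rewrite -(measure0 (mpower lam m)).
  have -> : set0 = \bigcap_k (B k `&` D).
    by rewrite bigcapIl// B0 set0I.
  apply: nonincreasing_cvg_mu => //.
  - apply: (@le_lt_trans _ _ (mpower lam m D)).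
      by apply: le_measure; rewrite ?inE//; exact: subIsetr.
    rewrite mpower_box//.
    have lF : lam (F N) \is a fin_num.
      by rewrite ge0_fin_numE//; case: (Foo N).
    rewrite -(fineK lF) prodEFin ltry//.
  - exact: bigcapT_measurable.
  - by move=> k l kl; apply/subsetPset; apply: setSI; exact/subsetPset/niB.
have e4L : (0 < e / 4 / L)%R by rewrite divr_gt0.
have /(cvge_0P _ (fun k => measure_ge0 (mpower lam m) _))/(_ _ e4L) := lamBD.
apply: filterS => k lamk i ii.
have mS A : measurable A -> measurable (sample X i @^-1` A).
  by move=> mA; rewrite -[X in measurable X]setTI; exact: msample.
apply: (@le_trans _ _ (P (sample X i @^-1` (B k `&` D)) +
    P (sample X i @^-1` ~` D))).
  apply: le_trans (measureU2 _ _ _) => //; last 2 first.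
  - exact: mS.
  - by apply: mS; exact: measurableC.
  apply: le_measure; rewrite ?inE.
  - exact: mS.
  - by apply: measurableU; apply: mS => //; exact: measurableC.
  - by move=> w Bw; have [Dw|nDw] := pselect (D (sample X i w)); [left|right].
have H1 : P (sample X i @^-1` (B k `&` D)) <= (e / 4 + e / 4)%:E.
  apply: le_trans (density_small_sets (hf i ii) q1 L0 (HM i ii) (mBD k)) _.
  rewrite EFinD; apply: leeD; last by rewrite lee_fin.
  apply: (@le_trans _ _ (L%:E * (e / 4 / L)%:E)).
    by apply: lee_wpmul2l => //; rewrite lee_fin ltW.
  by rewrite -EFinM mulrC divfK ?gt_eqF.
have H2 : P (sample X i @^-1` ~` D) <= (e / 4)%:E.
  apply: le_trans (sample_outside_box i (mF N)) _.
  apply: (@le_trans _ _ (m%:R%:E * (e / 4 / m.+1%:R)%:E)).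
    by apply: lee_wpmul2l => //; rewrite lee_fin.
  rewrite -EFinM lee_fin mulrCA ler_piMr ?(ltW e4)// ler_pdivrMr// mul1r.
  by rewrite ler_nat.
apply: le_trans (leeD H1 H2) _; rewrite -EFinD lee_fin; lra.
Qed.

End density.


(** * Convergence of U-statistics *)

Theorem theorem1p4 (R : realType)
    (dO : measure_display) (Omega : measurableType dO) (P : probability Omega R)
    (T Tinv : Omega -> Omega) (m d : nat) (p : R)
    (X0 : Omega -> Rvec R d) (h : m.-tuple (Rvec R d) -> R)
    (mu : Omega -> probability (Rvec R d) R) :
  (1 <= m)%N -> (1 <= d)%N -> 1 <= p ->
  measure_preserving_automorphism P T Tinv ->
  measurable_fun setT X0 ->
  measurable_fun setT h ->
  regular_cond_distribution P (invariant_sets T) X0 mu ->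
  let X := shift_process T Tinv X0 in
  let idx := [set i : m.-tuple nat | increasing_index i] in
  uniformly_integrable P idx (fun i w => `|h (sample X i w)| `^ p) ->
  (exists f : m.-tuple nat -> m.-tuple (Rvec R d) -> R,
    (forall i, idx i ->
       has_density (pushforward P (sample X i))
         (mpower (lebesgue_Rvec R d) m) (f i)) /\
    exists q0 : R, 1 < q0 /\
      (ereal_sup [set \int[mpower (lebesgue_Rvec R d) m]_t (f i t `^ q0)%:E
                 | i in idx] < +oo)%E) ->
  (exists f : Omega -> Rvec R d -> R,
    {ae P, forall w, has_density (mu w) (lebesgue_Rvec R d) (f w)} /\
    exists (Omega' : set Omega) (q1 : R),
      [/\ measurable Omega', P Omega' = 1%E, 1 < q1 &
        (ereal_sup [set \int[lebesgue_Rvec R d]_t (f w t `^ q1)%:E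
                   | w in Omega'] < +oo)%E]) ->
  (\int[P]_w \int[mpower (mu w) m]_x (`|h x| `^ p)%:E < +oo)%E ->
  (fun n => 'N[P]_(p%:E)[EFin \o (Ustat h X n \- random_integral mu h)%R])%E @ \oo --> 0%E.
Proof.
move=> _ _ p1 [mT _ _ _ PT] mX0 mh hmu X idx UI [f [fdens [q0 [q01 fsup]]]] _ hoo.
have vanishing := density_uniformly_vanishing mT PT mX0 fdens q01 fsup.
apply: (Uconverges_Lnorm p1).
exact: (Uconverges_uniformly_integrable mT PT mX0 hmu p1 vanishing mh hoo UI).
Qed.
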